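(* Let $Y=g(A^\top X)+\zeta$, where $X$ is a sub-Gaussian random vector in $\mathbb{R}^D$, $A\in\mathbb{R}^{D\times d}$ has orthonormal columns, $P=AA^\top$, $\mathbb{E}[\zeta\mid X]=0$ almost surely, and $\operatorname{Var}(\zeta\mid X)\le\sigma_\zeta^2$ almost surely. Let $f(x)=g(A^\top x)$ and assume $|f(X)|\le1$ almost surely. Let $\hat P$ be a deterministic orthogonal projection on $\mathbb{R}^D$ (an estimate of $P$), and let $\hat f_k$ be the kNN-estimator based on $N$ i.i.d. copies of $(X,Y)$ projected by $\hat P$. Let $g$ be $(L,s)$-smooth with $s\in(0,1]$, and $d>2s$. For $k=C_kN^{2s/(2s+d)}$, $$\mathbb{E}\big(\hat f_k(X)-f(X)\big)^2\le C_1N^{-\frac{2s}{2s+d}}+C_2\log(N)\,\|\hat P-P\|^{2s},$$ where $C_1$ depends on $d,\sigma_\zeta,\|X\|_{\psi_2},C_k,L,s$, and $C_2$ depends on the same quantities and additionally linearly on $D\|X\|_{\psi_2}^2$.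
   Context: $(X_i,Y_i)$, $i=1,\dots,N$, are i.i.d. copies of $(X,Y)$, and $(X,Y)$ denotes a further independent copy, over which the expectation is also taken. For a point $x\in\mathbb{R}^D$, let $1(x),\dots,N(x)$ be a reordering of the indices $1,\dots,N$ such that $\|\hat P(x-X_{i(x)})\|\le\|\hat P(x-X_{j(x)})\|$ for all $j\ge i$ and all $i$; the kNN-estimator is $\hat f_k(x):=k^{-1}\sum_{i=1}^kY_{i(x)}$. Smoothness: for $s=s_1+s_2$ with $s_1\in\mathbb{N}_0$, $s_2\in(0,1]$, a function $\phi:\mathbb{R}^m\to\mathbb{R}$ is $(L,s)$-smooth if the partial derivatives $\partial^\alpha\phi$ exist for all $\alpha\in\mathbb{N}_0^m$ with $\sum_i\alpha_i\le s_1$, and for all $\alpha$ with $\sum_i\alpha_i=s_1$ one has $|\partial^\alpha\phi(z)-\partial^\alpha\phi(z')|\le L\|z-z'\|^{s_2}$ for all $z,z'$. Here $g:\mathbb{R}^d\to\mathbb{R}$. $\|\cdot\|$ is the Euclidean norm of vectors and the spectral norm of matrices. For a real random variable $\|Z\|_{\psi_2}:=\inf\{t>0:\mathbb{E}\exp(Z^2/t^2)\le2\}$; for a random vector $\|Z\|_{\psi_2}:=\sup_{\|v\|=1}\|v^\top Z\|_{\psi_2}$; sub-Gaussian means this norm is finite. $k=C_kN^{2s/(2s+d)}$ with $C_k>0$ a constant such that $k$ is an integer in $\{1,\dots,N\}$. *)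

(* Defs.v *)
From HB Require Import structures.
From mathcomp Require Export all_boot all_order all_fingroup all_algebra.
From mathcomp Require Export all_classical all_reals all_analysis.
Export Order.TTheory GRing.Theory Num.Theory.
Export numFieldNormedType.Exports.

Set Implicit Arguments.
Unset Strict Implicit.
Unset Printing Implicit Defensive.

Local Open Scope classical_set_scope.
Local Open Scope ring_scope.

(* The Borel sigma-algebra on real matrices, in particular on R^n = 'cV[R]_n. *)
HB.instance Definition _ (R : realType) (m n : nat) :=
  @isMeasurable.Build (sigma_display (@open 'M[R]_(m, n))) 'M[R]_(m, n)
    <<s @open 'M[R]_(m, n) >> (@sigma_algebra0 _ _ _) (@sigma_algebraC _ _)
    (@sigma_algebra_bigcup _ _ _).

(* The library norm on matrices is the entrywise maximum, hence the explicit
   Euclidean and spectral norms. *)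
Definition enorm (R : realType) (n : nat) (x : 'cV[R]_n) : R :=
  Num.sqrt (\sum_(i < n) x i 0 ^+ 2).

Definition spectral_norm (R : realType) (m n : nat) (M : 'M[R]_(m, n)) : R :=
  sup [set enorm (M *m x) | x in [set x : 'cV[R]_n | enorm x <= 1]].

Definition orthonormal_columns (R : realType) (m n : nat) (A : 'M[R]_(m, n)) :=
  A^T *m A = 1%:M.

Definition orthogonal_projection (R : realType) (n : nat) (Q : 'M[R]_n) :=
  Q^T = Q /\ Q *m Q = Q.

(* A partial derivative of order r is indexed by the word of length r of the
   directions in which one differentiates (the last letter first); a
   multi-index alpha corresponds to the words in which each i occurs alpha_i
   times. *)
Fixpoint partial_derivative (R : realType) (m : nat) (l : seq 'I_m)
    (phi : 'cV[R]_m -> R) : 'cV[R]_m -> R :=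
  if l is i :: l' then
    fun z => derive (partial_derivative l' phi) z (delta_mx i 0)
  else phi.

Definition smooth (R : realType) (m : nat) (L s : R) (phi : 'cV[R]_m -> R) :=
  exists (s1 : nat) (s2 : R),
    [/\ s = s1%:R + s2,
        0 < s2 <= 1,
        forall (l : seq 'I_m) (i : 'I_m) (z : 'cV[R]_m), (size l < s1)%N ->
          derivable (partial_derivative l phi) z (delta_mx i 0) &
        forall (l : seq 'I_m), size l = s1 -> forall z z' : 'cV[R]_m,
          `|partial_derivative l phi z - partial_derivative l phi z'|
            <= L * enorm (z - z') `^ s2].

Section probability.
Context {d : measure_display} {T : measurableType d} {R : realType}.
Variable P : probability T R.

Definition psi2_norm (Z : T -> R) : \bar R :=
  ereal_inf [set t%:E | t in [set t : R |
    0 < t /\ ('E_P[fun w => expR (Z w ^+ 2 / t ^+ 2)] <= 2%:E)%E]].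

Definition psi2_norm_vec (n : nat) (X : T -> 'cV[R]_n) : \bar R :=
  ereal_sup [set psi2_norm (fun w => (v^T *m X w) 0 0) |
    v in [set v : 'cV[R]_n | enorm v = 1]].

Definition sub_gaussian (n : nat) (X : T -> 'cV[R]_n) :=
  (psi2_norm_vec X < +oo)%E.

(* h is a version of E[Z | X], i.e. of the conditional expectation of Z given
   the sigma-algebra generated by X. *)
Definition cond_expectation (d' : measure_display) (T' : measurableType d')
    (X : T -> T') (Z h : T -> R) :=
  [/\ P.-integrable setT (EFin \o Z),
      P.-integrable setT (EFin \o h),
      forall U : set R, measurable U ->
        g_sigma_algebra_preimage X (h @^-1` U) &
      forall B : set T, g_sigma_algebra_preimage X B ->
        (\int[P]_(w in B) (Z w)%:E = \int[P]_(w in B) (h w)%:E)%E].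

(* v is a version of Var(Z | X) = E[(Z - E[Z | X])^2 | X]. *)
Definition cond_variance (d' : measure_display) (T' : measurableType d')
    (X : T -> T') (Z v : T -> R) :=
  exists2 h : T -> R, cond_expectation X Z h &
    cond_expectation X (fun w => (Z w - h w) ^+ 2) v.

Definition mutually_independent (I : finType) (d' : measure_display)
    (T' : measurableType d') (Z : I -> T -> T') :=
  forall (J : {set I}) (B : I -> set T'), (forall i, measurable (B i)) ->
    (P (\bigcap_(i in [set` J]) (Z i @^-1` B i))
      = \prod_(i in J) P (Z i @^-1` B i))%E.

Definition same_distribution (d' : measure_display) (T' : measurableType d')
    (Z Z' : T -> T') :=
  forall B : set T', measurable B -> P (Z @^-1` B) = P (Z' @^-1` B).

(* The random elements Zs i are copies of Z, and the whole family consisting of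
   Z and all the Zs i is independent. *)
Definition iid_copies (N : nat) (d' : measure_display)
    (T' : measurableType d') (Z : T -> T') (Zs : 'I_N -> T -> T') :=
  mutually_independent (fun o : option 'I_N => if o is Some i then Zs i else Z)
  /\ forall i, same_distribution (Zs i) Z.

End probability.

(* The reordering i |-> i(x) is rho xs x, where xs are the sample points: ranks
   are counted from 0, so that 1(x) is rho xs x 0. Ties may be broken by any
   rule that is a measurable function of the sample points and of x; it may not
   look at the responses Y_i. *)
Definition nn_ordering (R : realType) (D N : nat) (Q : 'M[R]_D)
    (rho : N.-tuple 'cV[R]_D -> 'cV[R]_D -> 'S_N) :=
  (forall (xs : N.-tuple 'cV[R]_D) (x : 'cV[R]_D) (i j : 'I_N), (i <= j)%N ->
     enorm (Q *m (x - tnth xs (rho xs x i)))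
       <= enorm (Q *m (x - tnth xs (rho xs x j))))
  /\ forall p : 'S_N, measurable
       [set z : N.-tuple 'cV[R]_D * 'cV[R]_D | rho z.1 z.2 = p].

Definition knn_estimator (R : realType) (D N : nat)
    (rho : N.-tuple 'cV[R]_D -> 'cV[R]_D -> 'S_N) (k : nat)
    (xs : N.-tuple 'cV[R]_D) (ys : N.-tuple R) (x : 'cV[R]_D) : R :=
  k%:R^-1 * \sum_(i < N | (i < k)%N) tnth ys (rho xs x i).

(* Main.v *)
From HB Require Import structures.
Require Import Defs.
From mathcomp Require Import measurable_realfun ring lra zify.

(** The responses split as Y_i = f (X_i) + zeta_i, so the error of the average
    over the k selected neighbours is a noise term, the average of the zeta_i,
    plus a bias term, the average of f (X_i) - f (X); the risk is at most twice
    the sum of their mean squares.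

    Noise. The selection is a function of the points only. With all points but
    X_i frozen, averaging over (X_i, Y_i) kills every mixed term and bounds
    every square by sigma^2 times the probability of being selected. As k
    points are selected, the mean square is at most sigma^2 / k
    ([freezing_le], [freezing_centred], [noise_bound]).

    Bias. Write P for the projection A A^T, Q for its estimate and p = 2 s. By
    Hoelder continuity of g the squared bias is at most the average over the
    selected points of L^2 |P (X - X_i)|^p, and
    |P z| <= |Q z| + |Q - P| |z|.

    The second summand is of order |Q - P|^p max_i |X - X_i|^p. For each
    coordinate, y <= ln t + exp y / t turns the maximum over the sample into a
    sum of N + 1 exponentials of mean at most 2, and t = 2 (N + 1) yields the
    factor D K^2 log N ([mean_envelope], [diff_pow_le]).

    The first summand is a k-nearest-neighbour distance. When |Q - P| <= 1/2,
    the d numbers A^T Q z control |Q z| up to a factor 2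
    ([enorm_projection_coordinates]), so the effective dimension is d; when
    |Q - P| > 1/2, the first summand is dominated by the second. The k smallest
    distances have a sum not exceeding that of any k distinct ones
    ([smallest_sum_le]); taking the nearest point in each of k disjoint groups
    of about n = N / k sample points reduces the problem to one nearest
    neighbour among n points.

    One nearest neighbour. Cut R^d into dyadic cubes of side 2^-l. If a cube has
    mass a, the query lies in it and the n points miss it with probability
    a (1 - a)^n <= 1 / n, so inside a window of radius r the chance of a miss
    is about (2^l r)^d / n, to which the tail of the window is added. All
    moments being finite, a window radius that is a small power of n 2^(-l d)
    makes the total at most C (n 2^(-l d))^-g with g < 1 as close to 1 as
    needed. Since p < d, g may be taken above p / d, and then the sum over l of
    2^(-l p) times these bounds is dominated by the finest scale
    2^l = n^(1/d), which gives n^(-p/d) ([gap_le_multiscale],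
    [nearest_neighbour_rate]). With n of order N / k and k of order
    N^(p/(p+d)) this is N^(-p/(p+d)), the same order as sigma^2 / k. *)

Set Implicit Arguments.
Unset Strict Implicit.
Unset Printing Implicit Defensive.
Local Open Scope classical_set_scope.
Local Open Scope ring_scope.

(** * Euclidean norm, spectral norm and projections *)

Section Euclidean.
Variable R : realType.

Definition dot (n : nat) (x y : 'cV[R]_n) : R := \sum_(i < n) x i 0 * y i 0.

Lemma dot_mulmx (m n : nat) (M : 'M[R]_(m, n)) (x : 'cV[R]_n) (y : 'cV[R]_m) :
  dot (M *m x) y = dot x (M^T *m y).
Proof.
have dotE k (u v : 'cV[R]_k) : dot u v = (u^T *m v) 0 0.
  by rewrite mxE; apply: eq_bigr => i _; rewrite mxE.
by rewrite !dotE trmx_mul mulmxA.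
Qed.

Lemma enorm_ge0 (n : nat) (x : 'cV[R]_n) : 0 <= enorm x.
Proof. exact: sqrtr_ge0. Qed.

Lemma enorm_sqr (n : nat) (x : 'cV[R]_n) : enorm x ^+ 2 = dot x x.
Proof.
rewrite sqr_sqrtr; first by apply: eq_bigr => i _; rewrite expr2.
by apply: sumr_ge0 => i _; exact: sqr_ge0.
Qed.

(** Lagrange's identity: the double sum of squares
    (x_i y_j - x_j y_i)^2 is twice the defect in the inequality. *)
Lemma cauchy_schwarz (n : nat) (x y : 'cV[R]_n) :
  dot x y ^+ 2 <= dot x x * dot y y.
Proof.
have : 0 <= \sum_(i < n) \sum_(j < n) (x i 0 * y j 0 - x j 0 * y i 0) ^+ 2.
  by apply: sumr_ge0 => i _; apply: sumr_ge0 => j _; exact: sqr_ge0.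
have -> : \sum_(i < n) \sum_(j < n) (x i 0 * y j 0 - x j 0 * y i 0) ^+ 2 =
    \sum_(i < n) \sum_(j < n) ((x i 0 * x i 0) * (y j 0 * y j 0)) +
    \sum_(i < n) \sum_(j < n) ((y i 0 * y i 0) * (x j 0 * x j 0)) -
    (\sum_(i < n) \sum_(j < n) ((x i 0 * y i 0) * (x j 0 * y j 0))) *+ 2.
  rewrite -sumrMnl -big_split /= -sumrB; apply: eq_bigr => i _.
  rewrite -sumrMnl -big_split /= -sumrB; apply: eq_bigr => j _.
  by ring.
have dd (a b c e : 'cV[R]_n) :
    \sum_(i < n) \sum_(j < n) ((a i 0 * b i 0) * (c j 0 * e j 0)) =
    dot a b * dot c e.
  by rewrite /dot big_distrlr.
rewrite !dd mulr2n; move: (dot x y) (dot x x) (dot y y) => a b c.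
by rewrite expr2; lra.
Qed.

Lemma dot_le (n : nat) (x y : 'cV[R]_n) : `|dot x y| <= enorm x * enorm y.
Proof.
rewrite -[leRHS]ger0_norm ?mulr_ge0 ?enorm_ge0//.
rewrite -ler_sqr ?nnegrE// !real_normK ?num_real// exprMn !enorm_sqr.
exact: cauchy_schwarz.
Qed.

Lemma enormD (n : nat) (x y : 'cV[R]_n) : enorm (x + y) <= enorm x + enorm y.
Proof.
rewrite -ler_sqr ?nnegrE ?addr_ge0 ?enorm_ge0//.
have -> : enorm (x + y) ^+ 2 = enorm x ^+ 2 + enorm y ^+ 2 + dot x y *+ 2.
  rewrite !enorm_sqr /dot -sumrMnl -!big_split /=.
  by apply: eq_bigr => i _; rewrite !mxE; ring.
have := dot_le x y; have := ler_norm (dot x y).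
by rewrite sqrrD mulr2n mulr2n; lra.
Qed.

Lemma enormN (n : nat) (x : 'cV[R]_n) : enorm (- x) = enorm x.
Proof. by congr Num.sqrt; apply: eq_bigr => i _; rewrite mxE sqrrN. Qed.

Lemma enormZ (n : nat) (a : R) (x : 'cV[R]_n) :
  enorm (a *: x) = `|a| * enorm x.
Proof.
rewrite /enorm -sqrtr_sqr -sqrtrM ?sqr_ge0//; congr Num.sqrt.
by rewrite mulr_sumr; apply: eq_bigr => i _; rewrite mxE exprMn.
Qed.

Lemma enorm0 (n : nat) : enorm (0 : 'cV[R]_n) = 0.
Proof. by rewrite -(scale0r 0) enormZ normr0 mul0r. Qed.

Lemma enorm_eq0 (n : nat) (x : 'cV[R]_n) : enorm x = 0 -> x = 0.
Proof.
move=> x0; have : dot x x = 0 by rewrite -enorm_sqr x0 expr0n.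
move=> /eqP; rewrite psumr_eq0; last by move=> i _; rewrite -expr2 sqr_ge0.
move=> /allP h; apply/colP => i; rewrite mxE; apply/eqP.
by have := h i (mem_index_enum i); rewrite mulf_eq0 orbb.
Qed.

Lemma enorm_le_sum (n : nat) (x : 'cV[R]_n) : enorm x <= \sum_(i < n) `|x i 0|.
Proof.
have s0 : 0 <= \sum_(i < n) `|x i 0| by apply: sumr_ge0.
rewrite -ler_sqr ?nnegrE ?enorm_ge0// enorm_sqr expr2 mulr_suml /dot.
apply: ler_sum => i _; rewrite -[leLHS]ger0_norm -?expr2 ?sqr_ge0//.
rewrite normrX expr2 ler_wpM2l// (bigD1 i)//= lerDl.
by apply: sumr_ge0.
Qed.

Lemma enorm_mulmx_bounded (m n : nat) (M : 'M[R]_(m, n)) :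
  has_ubound [set enorm (M *m x) | x in [set x : 'cV[R]_n | enorm x <= 1]].
Proof.
exists (\sum_(i < m) enorm (row i M)^T) => _ [x x1 <-].
apply: (le_trans (enorm_le_sum _)); apply: ler_sum => i _.
have -> : (M *m x) i 0 = dot (row i M)^T x.
  by rewrite mxE; apply: eq_bigr => j _; rewrite !mxE.
by apply: (le_trans (dot_le _ _)); rewrite ler_piMr ?enorm_ge0.
Qed.

Lemma spectral_norm_ge0 (m n : nat) (M : 'M[R]_(m, n)) : 0 <= spectral_norm M.
Proof.
apply: (le_trans (enorm_ge0 (M *m 0))); apply: ub_le_sup.
  exact: enorm_mulmx_bounded.
by exists 0 => //=; rewrite enorm0 ler01.
Qed.

Lemma enorm_mulmx_le (m n : nat) (M : 'M[R]_(m, n)) (x : 'cV[R]_n) :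
  enorm (M *m x) <= spectral_norm M * enorm x.
Proof.
have [x0|x0] := eqVneq (enorm x) 0.
  by rewrite (enorm_eq0 x0) mulmx0 !enorm0 mulr0.
have xp : 0 < enorm x by rewrite lt_neqAle eq_sym x0 enorm_ge0.
rewrite -ler_pdivrMr//.
have -> : enorm (M *m x) / enorm x = enorm (M *m ((enorm x)^-1 *: x)).
  by rewrite -scalemxAr enormZ ger0_norm ?invr_ge0 ?enorm_ge0// mulrC.
apply: ub_le_sup; first exact: enorm_mulmx_bounded.
exists ((enorm x)^-1 *: x) => //=.
by rewrite enormZ ger0_norm ?invr_ge0 ?enorm_ge0// mulVf.
Qed.

Lemma enorm_projection (n : nat) (Q : 'M[R]_n) (x : 'cV[R]_n) :
  orthogonal_projection Q -> enorm (Q *m x) <= enorm x.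
Proof.
move=> [QT QQ]; have [x0|x0] := eqVneq (enorm (Q *m x)) 0.
  by rewrite x0 enorm_ge0.
have xp : 0 < enorm (Q *m x) by rewrite lt_neqAle eq_sym x0 enorm_ge0.
rewrite -(ler_pM2r xp) -expr2 enorm_sqr dot_mulmx QT mulmxA QQ.
exact: le_trans (ler_norm _) (dot_le _ _).
Qed.

Lemma enorm_orthonormal (m n : nat) (A : 'M[R]_(m, n)) (y : 'cV[R]_n) :
  orthonormal_columns A -> enorm (A *m y) = enorm y.
Proof.
move=> AA; apply/eqP; rewrite -(@eqrXn2 _ 2) ?enorm_ge0//; apply/eqP.
by rewrite !enorm_sqr dot_mulmx mulmxA AA mul1mx.
Qed.

Lemma projection_orthonormal (m n : nat) (A : 'M[R]_(m, n)) :
  orthonormal_columns A -> orthogonal_projection (A *m A^T).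
Proof.
move=> AA; split; first by rewrite trmx_mul trmxK.
by rewrite mulmxA -(mulmxA A) AA mulmx1.
Qed.

Lemma enorm_trmx_orthonormal (m n : nat) (A : 'M[R]_(m, n)) (x : 'cV[R]_m) :
  orthonormal_columns A -> enorm (A^T *m x) = enorm (A *m A^T *m x).
Proof. by move=> AA; rewrite -mulmxA (enorm_orthonormal _ AA). Qed.

Lemma enorm_trmx_orthonormal_le (m n : nat) (A : 'M[R]_(m, n)) (x : 'cV[R]_m) :
  orthonormal_columns A -> enorm (A^T *m x) <= enorm x.
Proof.
move=> AA; rewrite (enorm_trmx_orthonormal _ AA).
exact/enorm_projection/projection_orthonormal.
Qed.

(** P = A A^T moves the vector Q x of the range of Q by at most |Q - P| |Q x|,
    hence |Q x| <= |P Q x| + |Q x| / 2, and |P Q x| = |A^T Q x|. The d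
    coordinates A^T Q x thus control |Q x| whatever the rank of Q. *)
Lemma enorm_projection_coordinates (m n : nat) (A : 'M[R]_(m, n)) (Q : 'M[R]_m)
    (x : 'cV[R]_m) :
  orthonormal_columns A -> orthogonal_projection Q ->
  spectral_norm (Q - A *m A^T) <= 2^-1 ->
  enorm (Q *m x) <= 2 * enorm (A^T *m (Q *m x)).
Proof.
move=> AA [QT QQ] QP; set z := Q *m x.
have Qz : Q *m z = z by rewrite /z mulmxA QQ.
have -> : enorm (A^T *m z) = enorm (A *m A^T *m z).
  exact: enorm_trmx_orthonormal.
have := enormD ((Q - A *m A^T) *m z) (A *m A^T *m z).
rewrite -mulmxDl subrK Qz.
have := enorm_mulmx_le (Q - A *m A^T) z.
have := enorm_ge0 z; set a := enorm z; set b := spectral_norm _ in QP *.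
nra.
Qed.

Lemma enorm_trmx_perturbation (m n : nat) (A : 'M[R]_(m, n)) (Q : 'M[R]_m)
    (x : 'cV[R]_m) :
  orthonormal_columns A ->
  enorm (A^T *m x) <=
    enorm (Q *m x) + spectral_norm (Q - A *m A^T) * enorm x.
Proof.
move=> AA; rewrite (enorm_trmx_orthonormal _ AA).
have -> : A *m A^T *m x = Q *m x - (Q - A *m A^T) *m x.
  by rewrite mulmxBl opprB addrC subrK.
apply: (le_trans (enormD _ _)); rewrite enormN lerD2l.
exact: enorm_mulmx_le.
Qed.

End Euclidean.

(** * Averaging one member of an independent family, the others frozen *)

Section Freezing.
Local Open Scope ereal_scope.
Context {disp : measure_display} {Omega : measurableType disp} {R : realType}.
Variable Pr : probability Omega R.
Context {d1 d2 : measure_display} {T1 : measurableType d1}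
  {T2 : measurableType d2}.
Variables (W : Omega -> T1) (V : Omega -> T2).
Hypotheses (mW : measurable_fun setT W) (mV : measurable_fun setT V).
Hypothesis WV : forall B C, measurable B -> measurable C ->
  Pr (W @^-1` B `&` V @^-1` C) = Pr (W @^-1` B) * Pr (V @^-1` C).

(** The joint law of independent W and V is the product of their laws, so by
    Tonelli's theorem V may be frozen while W is averaged. *)
Lemma freezing_ge0 (F : (T1 * T2)%type -> \bar R) :
  measurable_fun [set: T1 * T2] F -> (forall z, 0 <= F z) ->
  \int[Pr]_w F (W w, V w) = \int[Pr]_w \int[Pr]_u F (W u, V w).
Proof.
move=> mF F0.
pose W' : {mfun Omega >-> T1} := HB.pack W (isMeasurableFun.Build _ _ _ _ W mW).
pose V' : {mfun Omega >-> T2} := HB.pack V (isMeasurableFun.Build _ _ _ _ V mV).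
have mWV : measurable_fun setT (fun w => (W w, V w)).
  exact: measurable_fun_pair.
pose WV' : {mfun Omega >-> (T1 * T2)%type} :=
  HB.pack (fun w => (W w, V w)) (isMeasurableFun.Build _ _ _ _ _ mWV).
pose m1 : probability T1 R := distribution Pr W'.
pose m2 : probability T2 R := distribution Pr V'.
pose m12 : probability (T1 * T2)%type R := distribution Pr WV'.
have mE X : measurable X -> (m1 \x m2) X = m12 X.
  apply: product_measure_unique => A B mA mB.
  by rewrite /= /pushforward -WV.
transitivity (\int[m12]_z F z).
  by rewrite ge0_integral_distribution.
transitivity (\int[m1 \x m2]_z F z).
  by apply: eq_measure_integral => A mA _; exact: (esym (mE A mA)).
rewrite (fubini_tonelli2 _ mF F0).
have mG := measurable_fun_fubini_tonelli_G (m1 := m1) F mF F0.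
have G0 v : 0 <= fubini_G m1 F v by apply: integral_ge0.
rewrite (ge0_integral_pushforward mV Pr measurableT mG)//.
apply: eq_integral => w _ /=.
rewrite /fubini_G ge0_integral_distribution//.
by apply: (measurableT_comp mF); exact: measurable_fun_pair.
Qed.

(** An inequality between conditional means given V integrates to one between
    means. *)
Lemma freezing_le (F G : (T1 * T2)%type -> \bar R) :
  measurable_fun [set: T1 * T2] F -> (forall z, 0 <= F z) ->
  measurable_fun [set: T1 * T2] G -> (forall z, 0 <= G z) ->
  (forall w, \int[Pr]_u F (W u, V w) <= \int[Pr]_u G (W u, V w)) ->
  \int[Pr]_w F (W w, V w) <= \int[Pr]_w G (W w, V w).
Proof.
move=> mF F0 mG G0 FG; rewrite !freezing_ge0//.
pose W' : {mfun Omega >-> T1} := HB.pack W (isMeasurableFun.Build _ _ _ _ W mW).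
pose m1 : probability T1 R := distribution Pr W'.
have mI (H : (T1 * T2)%type -> \bar R) : measurable_fun [set: T1 * T2] H ->
    (forall z, 0 <= H z) ->
    measurable_fun setT (fun w => \int[Pr]_u H (W u, V w)).
  move=> mH H0; have mH1 := measurable_fun_fubini_tonelli_G (m1 := m1) H mH H0.
  have := measurableT_comp mH1 mV; congr (measurable_fun _ _).
  apply/funext => w /=; rewrite /fubini_G ge0_integral_distribution//.
  by apply: (measurableT_comp mH); exact: measurable_fun_pair.
by apply: ge0_le_integral => //; [move=> w _; exact: integral_ge0|exact: mI..].
Qed.

(** The positive and negative parts of F have equal means once V is frozen, so
    the nonnegative case applied to both of them suffices. *)
Lemma freezing_centred (F : (T1 * T2)%type -> R) :
  measurable_fun [set: T1 * T2] F ->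
  Pr.-integrable setT (fun w => (F (W w, V w))%:E) ->
  (forall w, Pr.-integrable setT (fun u => (F (W u, V w))%:E) /\
     \int[Pr]_u (F (W u, V w))%:E = 0) ->
  \int[Pr]_w (F (W w, V w))%:E = 0.
Proof.
move=> mF iF F0.
have mEF : measurable_fun [set: T1 * T2] (EFin \o F) by exact/measurable_EFinP.
have E0 (h : Omega -> \bar R) : Pr.-integrable setT h -> \int[Pr]_w h w = 0 ->
    \int[Pr]_w h^\+ w = \int[Pr]_w h^\- w.
  move=> ih; rewrite integralE.
  have : \int[Pr]_w h^\- w \is a fin_num by exact: integrable_neg_fin_num.
  have : \int[Pr]_w h^\+ w \is a fin_num by exact: integrable_pos_fin_num.
  move=> /fineK <- /fineK <- /eqP.
  by rewrite -EFinB eqe subr_eq0 => /eqP ->.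
suff h : \int[Pr]_w (fun w => (F (W w, V w))%:E)^\+ w =
    \int[Pr]_w (fun w => (F (W w, V w))%:E)^\- w.
  rewrite integralE h subee//; exact: integrable_neg_fin_num.
have fp := freezing_ge0 (measurable_funepos mEF) (funepos_ge0 (EFin \o F)).
have fn := freezing_ge0 (measurable_funeneg mEF) (funeneg_ge0 (EFin \o F)).
transitivity (\int[Pr]_w (EFin \o F)^\+ (W w, V w)).
  by apply: eq_integral => w _; rewrite !funeposE.
transitivity (\int[Pr]_w (EFin \o F)^\- (W w, V w)); last first.
  by apply: eq_integral => w _; rewrite !funenegE.
rewrite fp fn.
apply: eq_integral => w _; have [iw Iw] := F0 w.
have := E0 _ iw Iw.
under eq_integral do rewrite funeposE.
under [X in _ = X -> _]eq_integral do rewrite funenegE.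
move=> h0; under eq_integral do rewrite funeposE.
by under [RHS]eq_integral do rewrite funenegE.
Qed.

End Freezing.

Section Exclusion.
Context {disp : measure_display} {Omega : measurableType disp} {R : realType}.
Variable Pr : probability Omega R.
Context {d1 : measure_display} {T1 : measurableType d1} {I : finType}.
Variable Z : I -> Omega -> T1.
Hypothesis mZ : forall o, measurable_fun setT (Z o).
Hypothesis indepZ : mutually_independent Pr Z.

(** The member o is replaced by a dummy value instead of being dropped: the
    tuple keeps the indexing of the whole family, and is still independent of
    Z o. *)
Definition others (o : I) (w : Omega) : #|I|.-tuple T1 :=
  [tuple if enum_val j == o then point else Z (enum_val j) w | j < #|I|].

Lemma measurable_others (o : I) : measurable_fun setT (others o).
Proof.
apply/measurable_fun_tnthP => j.
rewrite (_ : _ \o _ = if enum_val j == o then cst point else Z (enum_val j)).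
  by case: ifP.
by apply/funext => w /=; rewrite tnth_mktuple; case: ifP.
Qed.

Lemma tnth_others (o o' : I) (w : Omega) : o' != o ->
  tnth (others o w) (enum_rank o') = Z o' w.
Proof. by move=> oo'; rewrite tnth_mktuple enum_rankK (negbTE oo'). Qed.

Definition boxes : set (set (#|I|.-tuple T1)) :=
  [set C | exists2 B : I -> set T1, (forall o, measurable (B o)) &
    C = [set t | forall o, B o (tnth t (enum_rank o))]].

Lemma measurable_tuple_boxes : @measurable _ (#|I|.-tuple T1) = <<s boxes >>.
Proof.
rewrite eqEsubset; split; last first.
  apply: smallest_sub; first exact: sigma_algebra_measurable.
  move=> _ [B mB ->].
  rewrite (_ : [set t | _] = \bigcap_(o in [set: I])
      ((fun t : #|I|.-tuple T1 => tnth t (enum_rank o)) @^-1` B o)).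
    apply: fin_bigcap_measurable => // o _; rewrite -[X in measurable X]setTI.
    exact: measurable_tnth.
  by apply/seteqP; split => [t h o _|t h o]; [exact: h|exact: (h o Logic.I)].
apply: smallest_sub; first exact: smallest_sigma_algebra.
move=> C; rewrite -bigcup_seq/= => -[j _ [B mB <-]].
apply: sub_sigma_algebra.
exists (fun o => if enum_rank o == j then B else setT).
  by move=> o; case: ifP.
rewrite setTI; apply/seteqP; split => [t /= Bt o|t /= h].
  by case: eqP => [->|].
by have := h (enum_val j); rewrite enum_valK eqxx.
Qed.

Local Open Scope ereal_scope.

Lemma independent_setT (B : I -> set T1) : (forall o, measurable (B o)) ->
  Pr [set w | forall o, B o (Z o w)] = \prod_(o : I) Pr (Z o @^-1` B o).
Proof.
move=> mB; have := indepZ [set: I]%SET mB.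
under [in RHS]eq_bigl do rewrite inE.
move=> <-; congr (Pr _); apply/seteqP; split => [w h o _|w h o]; first exact: h.
by apply: h => /=; rewrite inE.
Qed.

(** Both sides are additive in C, so the pi-lambda theorem reduces C to a box.
    The o-th side of the box only sees the dummy value: either it misses that
    value and the event is empty, or it imposes no condition. *)
Lemma independent_others (o : I) (B : set T1) (C : set (#|I|.-tuple T1)) :
  measurable B -> measurable C ->
  Pr (Z o @^-1` B `&` others o @^-1` C) =
  Pr (Z o @^-1` B) * Pr (others o @^-1` C).
Proof.
move=> mB mC.
have mpre d' (T' : measurableType d') (h : Omega -> T') A :
    measurable_fun setT h -> measurable A -> measurable (h @^-1` A).
  by move=> mh mA; rewrite -[X in measurable X]setTI; exact: mh.
have mZB : measurable (Z o @^-1` B) by exact: mpre (mZ o) mB.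
have mo := measurable_others o.
pose P (A : set (#|I|.-tuple T1)) := Pr (Z o @^-1` B `&` others o @^-1` A) =
  Pr (Z o @^-1` B) * Pr (others o @^-1` A).
suff : P C by [].
have sC : <<s boxes >> C by rewrite -measurable_tuple_boxes.
have finP A : measurable A -> Pr A \is a fin_num.
  by move=> mA; exact: fin_num_measure.
move: C sC {mC}; apply: (@dynkin_induction _ _ boxes).
- exact: measurable_tuple_boxes.
- move=> _ _ [B1 mB1 ->] [B2 mB2 ->].
  exists (fun i => B1 i `&` B2 i); first by move=> i; exact: measurableI.
  by apply/seteqP; split => [t [h1 h2] i|t h]; [split|split => i; case: (h i)].
- by rewrite /P !preimage_setT setIT probability_setT mule1.
- move=> _ [B' mB' ->].
  have [/asboolP ptB|/asboolP ptB] := boolP `[< B' o point >]; last first.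
    have E0 :
      others o @^-1` [set t | forall i, B' i (tnth t (enum_rank i))] = set0.
      rewrite -subset0 => w /= /(_ o); rewrite tnth_mktuple enum_rankK eqxx.
      by [].
    by rewrite /P E0 setI0 measure0 mule0.
  have EC : others o @^-1` [set t | forall i, B' i (tnth t (enum_rank i))] =
      [set w | forall i, (if i == o then setT else B' i) (Z i w)].
    apply/seteqP; split => w /= h i; have := h i.
      by rewrite tnth_mktuple enum_rankK; case: eqP => [->|].
    by rewrite tnth_mktuple enum_rankK; case: eqP => [->|].
  have ECB : Z o @^-1` B `&`
        others o @^-1` [set t | forall i, B' i (tnth t (enum_rank i))] =
      [set w | forall i, (if i == o then B else B' i) (Z i w)].
    rewrite EC; apply/seteqP; split => [w /= [hB h] i|w /= h].
      by have := h i; case: eqP => [->|].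
    split => [|i]; first by have := h o; rewrite eqxx.
    by have := h i; case: eqP.
  rewrite /P ECB EC (@independent_setT (fun i => if i == o then B else B' i)).
  rewrite (@independent_setT (fun i => if i == o then setT else B' i)).
  rewrite (bigD1 o)//= eqxx [in RHS](bigD1 o)//= eqxx preimage_setT.
  rewrite probability_setT mul1e; congr (_ * _).
  by apply: eq_bigr => i /negbTE ->.
  + by move=> i; case: ifP.
  + by move=> i; case: ifP.
- move=> S mS PS; rewrite /P preimage_setC.
  have mS' := mpre _ _ _ _ mo mS.
  rewrite probability_setC// -setDE measureD//; last first.
    by rewrite ltey_eq finP.
  rewrite [X in _ - X]PS -/(others o @^-1` S).
  have key (a b : \bar R) : a \is a fin_num -> b \is a fin_num ->
      a - a * b = a * (1 - b).
    by move=> fa fb; rewrite muleBr// ?mule1//.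
  by apply: key; exact: finP.
- move=> F mF tF PF; rewrite /P preimage_bigcup setI_bigcupr.
  have tp : trivIset setT (fun k => others o @^-1` F k).
    apply/trivIsetP => i j _ _ ij; rewrite -preimage_setI.
    move/trivIsetP : tF => /(_ _ _ Logic.I Logic.I ij) ->.
    exact: preimage_set0.
  have mFk k := mpre _ _ _ _ mo (mF k).
  rewrite measure_bigcup//; last 2 first.
  + by move=> k _; exact: measurableI.
  + by apply: trivIset_setIl.
  rewrite [in RHS]measure_bigcup//.
  rewrite -[X in _ = X * _](fineK (finP _ mZB)) -nneseriesZl//.
  by apply: eq_eseriesr => k _; rewrite fineK ?finP//; exact: PF.
Qed.

End Exclusion.

(** * The noise part of the nearest-neighbour average *)

Section Noise.
Context {disp : measure_display} {Omega : measurableType disp} {R : realType}.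
Variable Pr : probability Omega R.
Context {dS : measure_display} {S : measurableType dS} {I : finType}.
Variables (X : I -> Omega -> S) (Y : I -> Omega -> R) (f : S -> R) (v : R).
Hypotheses (mX : forall o, measurable_fun setT (X o))
  (mY : forall o, measurable_fun setT (Y o)) (mf : measurable_fun setT f).
Let Z (o : I) (w : Omega) : (S * R)%type := (X o w, Y o w).
Hypothesis indepZ : mutually_independent Pr Z.

Let zeta (o : I) (w : Omega) : R := Y o w - f (X o w).
Hypothesis v0 : 0 <= v.
Hypothesis int_zeta : forall o, Pr.-integrable setT (EFin \o zeta o).
Hypothesis mean_zeta : forall o B, measurable B ->
  (\int[Pr]_w (zeta o w * \1_B (X o w))%:E = 0)%E.
Hypothesis var_zeta : forall o B, measurable B ->
  (\int[Pr]_w (zeta o w ^+ 2 * \1_B (X o w))%:E <=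
     v%:E * Pr (X o @^-1` B))%E.

Definition design (w : Omega) : #|I|.-tuple S :=
  [tuple X (enum_val j) w | j < #|I|].

(** A o is the event, for the tuple of all points, that the point o is
    selected. *)
Variable A : I -> set (#|I|.-tuple S).
Hypothesis mA : forall o, measurable (A o).

Let mZ (o : I) : measurable_fun setT (Z o).
Proof. exact: measurable_fun_pair. Qed.

Let mzeta (o : I) : measurable_fun setT (zeta o).
Proof. by apply: measurable_funB => //; exact: measurableT_comp. Qed.

Lemma measurable_design : measurable_fun setT design.
Proof.
apply/measurable_fun_tnthP => j.
rewrite (_ : _ \o _ = X (enum_val j)) //.
by apply/funext => w /=; rewrite tnth_mktuple.
Qed.

(** The tuple of all points, with the point o read from z.1 and the other ones
    from z.2. *)
Let patch (o : I) (z : (S * R) * #|I|.-tuple (S * R)) : #|I|.-tuple S :=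
  [tuple if enum_val j == o then z.1.1 else (tnth z.2 j).1 | j < #|I|].

Let measurable_patch (o : I) : measurable_fun setT (patch o).
Proof.
apply/measurable_fun_tnthP => j.
have [eo|no] := boolP (enum_val j == o).
  rewrite (_ : _ \o _ = fst \o fst).
    by apply: measurableT_comp => //; exact: measurable_fst.
  by apply/funext => z /=; rewrite tnth_mktuple eo.
rewrite (_ : _ \o _ =
    fst \o ((fun t : #|I|.-tuple (S * R) => tnth t j) \o snd)).
  apply: measurableT_comp; first exact: measurable_fst.
  by apply: measurableT_comp => //; exact: measurable_tnth.
by apply/funext => z /=; rewrite tnth_mktuple (negbTE no).
Qed.

Let patchE (o : I) (w : Omega) : patch o (Z o w, others Z o w) = design w.
Proof.
apply: eq_from_tnth => j; rewrite !tnth_mktuple.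
by case: eqP => [<-|].
Qed.

(** The sample point number o, put back among the other ones frozen at w. *)
Let slice (o : I) (w : Omega) (C : set (#|I|.-tuple S)) : set S :=
  [set x | C (patch o ((x, 0), others Z o w))].

Let measurable_slice (o : I) (w : Omega) (C : set (#|I|.-tuple S)) :
  measurable C -> measurable (slice o w C).
Proof.
move=> mC.
rewrite (_ : slice o w C =
    (fun x => patch o ((x, 0), others Z o w)) @^-1` C) //.
rewrite -[X in measurable X]setTI.
have : measurable_fun setT (fun x : S => patch o ((x, 0), others Z o w)).
  apply: (measurableT_comp (measurable_patch o)).
  apply: measurable_fun_pair => //.
by apply.
Qed.

Let slice_indic (o : I) (w u : Omega) (C : set (#|I|.-tuple S)) :
  \1_C (patch o (Z o u, others Z o w)) = \1_(slice o w C) (X o u) :> R.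
Proof.
by rewrite !indicE; congr ((_ : bool)%:R); apply/idP/idP; rewrite !inE.
Qed.

Let mres (o : I) :
  measurable_fun setT (fun z : (S * R) * #|I|.-tuple (S * R) => z.1.2 - f z.1.1).
Proof.
have m1 : measurable_fun setT (fun z : (S * R) * #|I|.-tuple (S * R) => z.1.2).
  by apply: (measurableT_comp measurable_snd); exact: measurable_fst.
have m2 : measurable_fun setT (fun z : (S * R) * #|I|.-tuple (S * R) => z.1.1).
  by apply: (measurableT_comp measurable_fst); exact: measurable_fst.
by apply: measurable_funB => //; exact: (measurableT_comp mf).
Qed.

(** With the other points frozen, the event C constrains X o alone: it becomes
    X o in a slice of C, to which the conditional variance bound applies. *)
Lemma noise_diagonal (o : I) (C : set (#|I|.-tuple S)) : measurable C ->
  (\int[Pr]_w (zeta o w ^+ 2 * \1_C (design w))%:E <=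
     v%:E * Pr (design @^-1` C))%E.
Proof.
move=> mC.
have mo := measurable_others mZ o.
have ind := @independent_others _ _ _ Pr _ _ _ Z mZ indepZ o.
have mCp : measurable_fun setT (fun z => \1_C (patch o z) : R).
  by apply: measurableT_comp => //; exact: measurable_indic.
have mF : measurable_fun setT
    (fun z : (S * R) * #|I|.-tuple (S * R) =>
      ((z.1.2 - f z.1.1) ^+ 2 * \1_C (patch o z))%:E).
  apply/measurable_EFinP; apply: measurable_funM => //.
  by apply: measurable_funX; exact: mres.
have F0 (z : (S * R) * #|I|.-tuple (S * R)) :
    (0 <= ((z.1.2 - f z.1.1) ^+ 2 * \1_C (patch o z))%:E)%E.
  by rewrite lee_fin mulr_ge0 ?sqr_ge0.
have mG : measurable_fun setT (fun z => (v * \1_C (patch o z) : R)%:E).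
  by apply/measurable_EFinP; apply: measurable_funM.
have G0 z : (0 <= (v * \1_C (patch o z) : R)%:E)%E.
  by rewrite lee_fin mulr_ge0.
have vE (D : set Omega) : measurable D ->
    (\int[Pr]_w (v * \1_D w)%:E = v%:E * Pr D)%E.
  move=> mD; under eq_integral do rewrite EFinM.
  rewrite ge0_integralZl_EFin//.
    by rewrite integral_indic// setIT.
  by apply/measurable_EFinP; exact: measurable_indic.
have := freezing_le (mZ o) mo ind mF F0 mG G0.
under eq_integral do rewrite patchE.
under [X in (_ -> (_ <= X)%E) -> _]eq_integral do rewrite patchE.
rewrite (vE (design @^-1` C)); last first.
  by rewrite -[X in measurable X]setTI; exact: measurable_design.
apply => w.
under eq_integral do rewrite slice_indic.
under [leRHS]eq_integral do rewrite slice_indic.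
rewrite (vE (X o @^-1` slice o w C)); last first.
  by rewrite -[X in measurable X]setTI; apply: mX => //; exact: measurable_slice.
by apply: var_zeta; exact: measurable_slice.
Qed.
Let int_zeta2 (o : I) : Pr.-integrable setT (fun w => (zeta o w ^+ 2)%:E).
Proof.
apply/integrableP; split; first by apply/measurable_EFinP; exact: measurable_funX.
under eq_integral do rewrite gee0_abs ?lee_fin ?sqr_ge0//.
have := var_zeta o measurableT; rewrite preimage_setT probability_setT mule1.
under [X in (X <= _)%E -> _]eq_integral do rewrite indicT mulr1.
by move=> /le_lt_trans; apply; rewrite ltry.
Qed.

Let int_cross (o o' : I) (h : Omega -> R) : measurable_fun setT h ->
  (forall w, `|h w| <= 1) ->
  Pr.-integrable setT (fun w => (zeta o w * zeta o' w * h w)%:E).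
Proof.
move=> mh h1.
apply: (le_integrable _ _ _ (integrableD _ (int_zeta2 o) (int_zeta2 o'))) => //.
  apply/measurable_EFinP; apply: measurable_funM => //.
  exact: measurable_funM.
move=> w _ /=; rewrite lee_fin normrM.
rewrite [leRHS]ger0_norm ?addr_ge0 ?sqr_ge0//.
apply: (@le_trans _ _ `|zeta o w * zeta o' w|); first by rewrite ler_piMr.
rewrite normrM -(real_normK (num_real (zeta o w))).
rewrite -(real_normK (num_real (zeta o' w))).
have := normr_ge0 (zeta o w); have := normr_ge0 (zeta o' w).
set a := `|_|; set b := `|_|; move=> *; nra.
Qed.

(** With everything but the member o frozen, zeta o' is a constant and the two
    events constrain X o alone, so the mean of zeta o over a slice appears, and
    it vanishes. *)
Lemma noise_cross (o o' : I) (C C' : set (#|I|.-tuple S)) : o != o' ->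
  measurable C -> measurable C' ->
  (\int[Pr]_w ((zeta o w * zeta o' w *
     (\1_C (design w) * \1_C' (design w)))%:E) = 0)%E.
Proof.
move=> oo' mC mC'.
have mo := measurable_others mZ o.
have ind := @independent_others _ _ _ Pr _ _ _ Z mZ indepZ o.
pose F (z : (S * R) * #|I|.-tuple (S * R)) : R := (z.1.2 - f z.1.1) *
  ((tnth z.2 (enum_rank o')).2 - f (tnth z.2 (enum_rank o')).1) *
  (\1_C (patch o z) * \1_C' (patch o z)).
have mI C0 : measurable C0 -> measurable_fun setT (fun z => \1_C0 (patch o z) : R).
  by move=> mC0; apply: measurableT_comp => //; exact: measurable_indic.
have mt : measurable_fun setT
    (fun z : (S * R) * #|I|.-tuple (S * R) => tnth z.2 (enum_rank o')).
  exact: (measurableT_comp (measurable_tnth _) measurable_snd).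
have mF : measurable_fun setT F.
  apply: measurable_funM; last by apply: measurable_funM; exact: mI.
  apply: measurable_funM; first exact: mres.
  apply: measurable_funB; first exact: (measurableT_comp measurable_snd mt).
  exact: (measurableT_comp mf (measurableT_comp measurable_fst mt)).
have FE w : F (Z o w, others Z o w) = zeta o w * zeta o' w *
    (\1_C (design w) * \1_C' (design w)).
  by rewrite /F patchE tnth_others// eq_sym.
have md1 C0 : measurable C0 -> measurable_fun setT (fun w => \1_C0 (design w) : R).
  move=> mC0; apply: measurableT_comp; last exact: measurable_design.
  exact: measurable_indic.
have ind1 (T : Type) (B : set T) x : `|\1_B x : R| <= 1.
  by rewrite indicE; case: (_ \in _); rewrite ?normr1 ?normr0.
have FEi : (fun w => (F (Z o w, others Z o w))%:E) = (fun w =>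
    (zeta o w * zeta o' w * (\1_C (design w) * \1_C' (design w)))%:E).
  by apply/funext => w; rewrite FE.
rewrite -FEi; apply: (freezing_centred (mZ o) mo ind mF); rewrite ?FEi.
  apply: int_cross; first by apply: measurable_funM; exact: md1.
  by move=> w; rewrite normrM mulr_ile1.
move=> w.
pose B := slice o w C `&` slice o w C'.
have mB : measurable B by apply: measurableI; exact: measurable_slice.
have FwE u : (F (Z o u, others Z o w))%:E =
    ((zeta o' w)%:E * (zeta o u * \1_B (X o u))%:E)%E.
  rewrite /F tnth_others 1?eq_sym// !slice_indic /B indicI /= -EFinM.
  by congr EFin; rewrite /= /zeta; ring.
have iB : Pr.-integrable setT (fun u => (zeta o u * \1_B (X o u))%:E).
  apply: (le_integrable _ _ _ (int_zeta o)) => //.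
    apply/measurable_EFinP; apply: measurable_funM => //.
    by apply: measurableT_comp => //; exact: measurable_indic.
  by move=> u _ /=; rewrite lee_fin normrM ler_piMr.
split.
  by under eq_fun do rewrite FwE; exact: integrableZl.
under eq_integral do rewrite FwE.
by rewrite integralZl// mean_zeta// mule0.
Qed.

(** The squared sum is expanded; the mixed terms vanish since, once every other
    sample point is frozen, a centred response error remains. *)
Lemma noise_bound (c : R) :
  (forall w, \sum_(o : I) \1_(A o) (design w) <= c) ->
  (\int[Pr]_w ((\sum_(o : I) zeta o w * \1_(A o) (design w)) ^+ 2)%:E <=
     (v * c)%:E)%E.
Proof.
move=> Ac.
have md1 C0 : measurable C0 -> measurable_fun setT (fun w => \1_C0 (design w) : R).
  move=> mC0; apply: measurableT_comp; last exact: measurable_design.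
  exact: measurable_indic.
have ind1 (T : Type) (B : set T) x : `|\1_B x : R| <= 1.
  by rewrite indicE; case: (_ \in _); rewrite ?normr1 ?normr0.
pose q o o' w := zeta o w * zeta o' w *
  (\1_(A o) (design w) * \1_(A o') (design w)).
have iq o o' : Pr.-integrable setT (fun w => (q o o' w)%:E).
  apply: int_cross; first by apply: measurable_funM; exact: md1.
  by move=> w; rewrite normrM mulr_ile1.
have qE w : ((\sum_(o : I) zeta o w * \1_(A o) (design w)) ^+ 2)%:E =
    (\sum_(o : I) \sum_(o' : I) (q o o' w)%:E)%E.
  rewrite expr2 big_distrlr /= -sumEFin; apply: eq_bigr => o _.
  rewrite -sumEFin; apply: eq_bigr => o' _.
  by congr EFin; rewrite /q; ring.
under eq_integral do rewrite qE.
rewrite integral_sum//; last by move=> o; exact: integrable_sum.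
have mdA o : measurable (design @^-1` A o).
  by rewrite -[X in measurable X]setTI; exact: measurable_design.
apply: (@le_trans _ _ (\sum_(o : I) (v%:E * Pr (design @^-1` A o))%E)%E).
  apply: lee_sum => o _; rewrite integral_sum//.
  rewrite (bigD1 o)//= [X in (_ + X)%E]big1 ?adde0; last first.
    by move=> o' oo'; apply: noise_cross => //; rewrite eq_sym.
  apply: le_trans (noise_diagonal o (mA o)).
  rewrite le_eqVlt; apply/orP; left; apply/eqP; apply: eq_integral => w _.
  congr EFin; rewrite /q -expr2; congr (_ * _).
  by rewrite indicE; case: (_ \in _); rewrite ?mulr1 ?mulr0.
rewrite -ge0_sume_distrr; last by move=> o _; exact: measure_ge0.
rewrite EFinM lee_wpmul2l ?lee_fin//.
have -> : (\sum_(o : I) Pr (design @^-1` A o) =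
    \int[Pr]_w (\sum_(o : I) \1_(A o) (design w))%:E)%E.
  under [RHS]eq_integral do rewrite -sumEFin.
  rewrite ge0_integral_sum//; last by move=> o; apply/measurable_EFinP; exact: md1.
  apply: eq_bigr => o _.
  by rewrite -[in LHS](setIT (design @^-1` A o)) -integral_indic.
apply: (@le_trans _ _ (\int[Pr]_w (cst c%:E w))%E).
  apply: ge0_le_integral => //.
  - by move=> w _; rewrite lee_fin sumr_ge0.
  - by apply/measurable_EFinP; apply: measurable_sum => o; exact: md1.
  - by move=> w _; rewrite lee_fin.
rewrite integral_cst; last exact: measurableT.
by rewrite -[leRHS]mule1 -(probability_setT Pr).
Qed.

End Noise.

(** * Conditional mean and variance, and their transfer to the copies *)

Section Transfer.
Local Open Scope ereal_scope.
Context {disp : measure_display} {Omega : measurableType disp} {R : realType}.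
Variable Pr : probability Omega R.
Context {d' : measure_display} {T' : measurableType d'}.
Variables (Z Z' : Omega -> T').
Hypotheses (mZ : measurable_fun setT Z) (mZ' : measurable_fun setT Z').
Hypothesis ZZ' : same_distribution Pr Z Z'.

Lemma same_distribution_integral (F : T' -> \bar R) : measurable_fun setT F ->
  \int[Pr]_w F (Z w) = \int[Pr]_w F (Z' w).
Proof.
move=> mF.
have ge0 (G : T' -> \bar R) : measurable_fun setT G -> (forall y, 0 <= G y) ->
    \int[Pr]_w G (Z w) = \int[Pr]_w G (Z' w).
  move=> mG G0.
  have push (V : Omega -> T') (mV : measurable_fun setT V) :
      \int[Pr]_w G (V w) = \int[pushforward Pr V]_y G y.
    by rewrite (ge0_integral_pushforward mV)//.
  rewrite !push//; apply: eq_measure_integral => A mA _.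
  by rewrite /= /pushforward; exact: ZZ'.
rewrite integralE [RHS]integralE.
have cp (V : Omega -> T') :
    \int[Pr]_w (fun w => F (V w))^\+ w = \int[Pr]_w F^\+ (V w).
  by apply: eq_integral => w _; rewrite !funeposE.
have cn (V : Omega -> T') :
    \int[Pr]_w (fun w => F (V w))^\- w = \int[Pr]_w F^\- (V w).
  by apply: eq_integral => w _; rewrite !funenegE.
rewrite !cp !cn; congr (_ - _); apply: ge0 => //.
  exact: measurable_funepos.
exact: measurable_funeneg.
Qed.

Lemma same_distribution_integrable (F : T' -> R) : measurable_fun setT F ->
  Pr.-integrable setT (fun w => (F (Z' w))%:E) ->
  Pr.-integrable setT (fun w => (F (Z w))%:E).
Proof.
move=> mF /integrableP[_ oo]; apply/integrableP; split.
  by apply/measurable_EFinP; exact: measurableT_comp.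
have mA : measurable_fun setT (fun y => `|(F y)%:E|).
  by apply: measurableT_comp => //; exact/measurable_EFinP.
by rewrite (same_distribution_integral mA).
Qed.

End Transfer.

Section Conditioning.
Context {disp : measure_display} {Omega : measurableType disp} {R : realType}.
Variable Pr : probability Omega R.
Context {d' : measure_display} {T' : measurableType d'}.
Variables (X : Omega -> T') (zeta m : Omega -> R).
Hypothesis mX : measurable_fun setT X.
Hypothesis mzeta : measurable_fun setT zeta.
Hypothesis zeta_m : cond_expectation Pr X zeta m.
Hypothesis m0 : {ae Pr, forall w, m w = 0}.

Let mpreX (B : set T') : measurable B -> measurable (X @^-1` B).
Proof. by move=> mB; rewrite -[X in measurable X]setTI; exact: mX. Qed.

Let sigmaX (B : set T') : measurable B -> g_sigma_algebra_preimage X (X @^-1` B).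
Proof. by move=> mB; exists B => //; rewrite setTI. Qed.

Let zeta_cell (C : set Omega) : g_sigma_algebra_preimage X C ->
  (\int[Pr]_(w in C) (zeta w)%:E = 0)%E.
Proof.
move=> gC; case: zeta_m => _ im _ ->//.
have mC : measurable C by case: gC => B mB <-; rewrite setTI; exact: mpreX.
have mm : measurable_fun setT m by case/integrableP: im => /measurable_EFinP.
rewrite (ae_eq_integral (cst 0%E)) ?integral0//.
- by apply/measurable_EFinP; exact: measurable_funS mm.
- by case: m0 => N [mN N0 sN]; exists N; split => // w /= h; apply: sN => /= e;
     apply: h => _; rewrite e.
Qed.

Lemma cond_mean_indic (B : set T') : measurable B ->
  (\int[Pr]_w (zeta w * \1_B (X w))%:E = 0)%E.
Proof.
move=> mB; rewrite -(zeta_cell (sigmaX mB)) [RHS]integral_mkcond.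
apply: eq_integral => w _; rewrite patchE indicE.
have -> : (w \in X @^-1` B) = (X w \in B) by apply/idP/idP; rewrite !inE.
by case: ifP; rewrite ?mulr1 ?mulr0.
Qed.

Variables (v : Omega -> R) (sigma : R).
Hypothesis zeta_v : cond_variance Pr X zeta v.
Hypothesis v_le : {ae Pr, forall w, v w <= sigma ^+ 2}.

(** The conditional mean h that centres the conditional variance has zero
    integral on every event of the sigma-algebra of X, in particular on
    {h >= 0} and on {h < 0}; hence h = 0 almost everywhere, and v is the
    conditional mean of zeta^2 itself. *)
Lemma cond_variance_indic (B : set T') : measurable B ->
  (\int[Pr]_w (zeta w ^+ 2 * \1_B (X w))%:E <=
     (sigma ^+ 2)%:E * Pr (X @^-1` B))%E.
Proof.
move=> mB; case: zeta_v => h [_ ih sh hE] [i2 iv _ vE].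
have mh : measurable_fun setT h by case/integrableP: ih => /measurable_EFinP.
have mv : measurable_fun setT v by case/integrableP: iv => /measurable_EFinP.
have h_cell C : g_sigma_algebra_preimage X C ->
    (\int[Pr]_(w in C) (h w)%:E = 0)%E.
  by move=> gC; rewrite -hE// zeta_cell.
have msig C : g_sigma_algebra_preimage X C -> measurable C.
  by case => A mA <-; rewrite setTI; exact: mpreX.
have gp : g_sigma_algebra_preimage X (h @^-1` `[0, +oo[) by exact: sh.
have gn : g_sigma_algebra_preimage X (h @^-1` `]-oo, 0[) by exact: sh.
have aep : ae_eq Pr (h @^-1` `[0, +oo[) (EFin \o h) (cst 0%E).
  apply/ae_eq_integral_abs; first exact: msig.
    by apply/measurable_EFinP; exact: measurable_funS mh.
  rewrite -[RHS](h_cell _ gp); apply: eq_integral => w.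
  by rewrite inE /= in_itv/= andbT => h0; rewrite ger0_norm.
have aen : ae_eq Pr (h @^-1` `]-oo, 0[) (EFin \o h) (cst 0%E).
  apply/ae_eq_integral_abs; first exact: msig.
    by apply/measurable_EFinP; exact: measurable_funS mh.
  rewrite -[RHS]oppe0 -(h_cell _ gn) -integralN/=; last first.
    apply: integrable_add_def; first exact: msig.
    by apply: integrableS ih => //; exact: msig.
  apply: eq_integral => w.
  by rewrite inE /= in_itv/= => h0; rewrite ltr0_norm.
have h0 : {ae Pr, forall w, h w = 0}.
  case: aep => N [mN N0 sN]; case: aen => M [mM M0 sM].
  exists (N `|` M); split; first exact: measurableU.
    by apply/eqP; rewrite measureU0// ; apply/eqP.
  move=> w /= hw; have [w0|w0] := leP 0 (h w).
    left; apply: sN => /= e; apply: hw.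
    by have := e; rewrite in_itv/= andbT => /(_ w0)[].
  right; apply: sM => /= e; apply: hw.
  by have := e; rewrite in_itv/= => /(_ w0)[].
have gB := sigmaX mB.
have mXB := mpreX mB.
have -> : (\int[Pr]_w (zeta w ^+ 2 * \1_B (X w))%:E =
    \int[Pr]_(w in X @^-1` B) ((zeta w - h w) ^+ 2)%:E)%E.
  rewrite [RHS]integral_mkcond; apply: ae_eq_integral => //.
  - apply/measurable_EFinP; apply: measurable_funM.
      exact: measurable_funX.
    by apply: measurableT_comp => //; exact: measurable_indic.
  - apply/(measurable_restrictT _ mXB).1; apply/measurable_EFinP.
    apply: measurable_funS measurableT _ _ => //.
    by apply: measurable_funX; exact: measurable_funB.
  - case: h0 => N [mN N0 sN]; exists N; split => // w /= hw; apply: sN => /= e.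
    apply: hw => _; rewrite patchE indicE e subr0.
    have -> : (w \in X @^-1` B) = (X w \in B) by apply/idP/idP; rewrite !inE.
    by case: ifP; rewrite ?mulr1 ?mulr0.
rewrite (vE _ gB) integralE.
apply: (@le_trans _ _ (\int[Pr]_(w in X @^-1` B) (fun w => (v w)%:E)^\+ w)%E).
  by rewrite -[leRHS]sube0 leeB// integral_ge0.
rewrite -[leRHS](@integral_cst _ _ _ Pr _ mXB).
apply: ae_ge0_le_integral => //.
- apply: measurable_funepos; apply/measurable_EFinP.
  exact: measurable_funS mv.
- by move=> w _; rewrite lee_fin sqr_ge0.
- case: v_le => N [mN N0 sN]; exists N; split => // w /= hw; apply: sN => /= e.
  by apply: hw => _; rewrite funeposE ge_max !lee_fin e sqr_ge0.
Qed.
End Conditioning.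

(** * Scalar inequalities and majorants with controlled mean *)

Section Scalar.
Variable R : realType.
Implicit Types (a x y : R) (n : nat).

(** (1 + a)^n >= n a by Bernoulli's inequality, and
    (1 + a)^n (1 - a)^n = (1 - a^2)^n <= 1. *)
Lemma missed_cell_le a n : 0 <= a <= 1 -> (0 < n)%N ->
  a * (1 - a) ^+ n <= n%:R^-1.
Proof.
move=> /andP[a0 a1] n0; have np : 0 < n%:R :> R by rewrite ltr0n.
rewrite -(ler_pM2l np) mulfV ?gt_eqF// mulrA.
have bern k : 1 + k%:R * a <= (1 + a) ^+ k.
  elim: k => [|k ih]; first by rewrite mul0r addr0 expr0.
  rewrite exprS; apply: (@le_trans _ _ ((1 + a) * (1 + k%:R * a))).
    have k0 : 0 <= k%:R :> R by rewrite ler0n.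
    have := mulr_ge0 k0 (mulr_ge0 a0 a0); rewrite -natr1; nra.
  by rewrite ler_wpM2l// addr_ge0.
have p0 : 0 <= (1 - a) ^+ n by rewrite exprn_ge0// subr_ge0.
apply: (@le_trans _ _ ((1 + a) ^+ n * (1 - a) ^+ n)).
  rewrite ler_wpM2r//; apply: le_trans (bern n); rewrite lerDr ler01//.
rewrite -exprMn; apply: exprn_ile1; nra.
Qed.

Lemma sum_pow_le (J : finType) (x : J -> R) (q : nat) : (forall j, 0 <= x j) ->
  (0 < #|J|)%N ->
  (\sum_(j : J) x j) ^+ q <= #|J|%:R ^+ q * (\sum_(j : J) x j ^+ q).
Proof.
move=> x0 /card_gt0P[j0 _].
have [j1 _ jmax] := @Order.TotalTheory.arg_maxP _ _ _ j0 xpredT x isT.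
have le1 : \sum_(j : J) x j <= #|J|%:R * x j1.
  rewrite mulr_natl -sumr_const; apply: ler_sum => j _; exact: jmax.
apply: (@le_trans _ _ ((#|J|%:R * x j1) ^+ q)).
  by apply: lerXn2r; rewrite ?nnegrE ?sumr_ge0// ?mulr_ge0.
rewrite exprMn ler_wpM2l ?exprn_ge0//.
by rewrite (bigD1 j1)//= lerDl sumr_ge0// => j _; exact: exprn_ge0.
Qed.

Lemma powR_le1D x (r : R) : 0 <= x -> 0 <= r <= 1 -> x `^ r <= 1 + x.
Proof.
move=> x0 /andP[r0 r1]; have [x1|x1] := leP 1 x.
  by apply: (le_trans (ler1_powR x1 r1)); rewrite lerDr.
apply: (@le_trans _ _ (1 `^ r)); last by rewrite powR1 lerDl.
by apply: ge0_ler_powR => //; rewrite ?nnegrE// ltW.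
Qed.

Lemma powRD_le x y (r : R) : 0 <= x -> 0 <= y -> 0 <= r <= 2 ->
  (x + y) `^ r <= 4 * (x `^ r + y `^ r).
Proof.
wlog xy : x y / x <= y.
  move=> h x0 y0 r2; have [|yx] := leP x y; first by move=> /h; exact.
  by rewrite addrC [X in _ * X]addrC; apply: h => //; exact: ltW.
move=> x0 y0 /andP[r0 r2].
apply: (@le_trans _ _ ((2 * y) `^ r)).
  by apply: ge0_ler_powR => //; rewrite ?nnegrE ?addr_ge0 ?mulr_ge0//; lra.
rewrite powRM//; apply: ler_pM; rewrite ?powR_ge0//; last first.
  by rewrite lerDr powR_ge0.
apply: (@le_trans _ _ (2 `^ 2%:R)); first by apply: ler_powR => //; lra.
by rewrite powR_mulrn//; lra.
Qed.

(** exp (y^2) = exp (y^2 / b)^b >= (y^2 / b)^b. *)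
Lemma powR_even_le_exp y (b : nat) : (0 < b)%N ->
  y ^+ (2 * b) <= b%:R ^+ b * expR (y ^+ 2).
Proof.
move=> b0; have bp : 0 < b%:R :> R by rewrite ltr0n.
have -> : y ^+ 2 = b%:R * (y ^+ 2 / b%:R) by field; rewrite gt_eqF.
rewrite expRM_natl -exprMn exprM; apply: lerXn2r; rewrite ?nnegrE ?sqr_ge0//.
apply: (@le_trans _ _ (b%:R * (1 + y ^+ 2 / b%:R))).
  by rewrite mulrDr mulr1 mulrCA mulfV ?gt_eqF// mulr1 lerDr ltW.
by rewrite ler_pM2l// expR_ge1Dx.
Qed.

(** The tangent inequality 1 + t <= exp t at t = y - ln x. *)
Lemma le_ln_exp x y : 0 < x -> y <= ln x + expR y / x.
Proof.
move=> x0; have := expR_ge1Dx (y - ln x).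
by rewrite expRB lnK ?posrE//; lra.
Qed.

End Scalar.

Section MeanBound.
Context {disp : measure_display} {Omega : measurableType disp} {R : realType}.
Variable Pr : probability Omega R.
Implicit Types (h : Omega -> R) (c : R).

(** Errors are bounded pointwise by functions of this kind, which are sums of
    explicit terms. The nearest point of a group occurs only in the pointwise
    inequalities, so it need not be chosen measurably. *)
Definition mean_le h c := [/\ measurable_fun setT h, forall w, 0 <= h w &
  (\int[Pr]_w (h w)%:E <= c%:E)%E].

Lemma mean_le_trans h c c' : c <= c' -> mean_le h c -> mean_le h c'.
Proof.
by move=> cc' [mh h0 hc]; split => //; apply: (le_trans hc); rewrite lee_fin.
Qed.

Lemma mean_le_cst c : 0 <= c -> mean_le (cst c) c.
Proof.
move=> c0; split => //.
rewrite (eq_integral (cst c%:E))// integral_cst; last exact: measurableT.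
by rewrite -[leRHS]mule1 -(probability_setT Pr).
Qed.

Lemma mean_leD h h' c c' : mean_le h c -> mean_le h' c' ->
  mean_le (fun w => h w + h' w) (c + c').
Proof.
move=> [mh h0 hc] [mh' h0' hc']; split; first exact: measurable_funD.
  by move=> w; rewrite addr_ge0.
under eq_integral do rewrite EFinD.
rewrite ge0_integralD//; do ?[exact/measurable_EFinP].
by rewrite EFinD leeD.
by move=> w _; rewrite lee_fin.
by move=> w _; rewrite lee_fin.
Qed.

Lemma mean_leZ (a : R) h c : 0 <= a -> mean_le h c ->
  mean_le (fun w => a * h w) (a * c).
Proof.
move=> a0 [mh h0 hc]; split; first exact: measurable_funM.
  by move=> w; rewrite mulr_ge0.
under eq_integral do rewrite EFinM.
rewrite ge0_integralZl_EFin//; last exact/measurable_EFinP.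
  by rewrite EFinM lee_wpmul2l ?lee_fin.
by move=> w _; rewrite lee_fin.
Qed.

Lemma mean_le_sum (J : Type) (r : seq J) (Q : pred J) (h : J -> Omega -> R)
    (c : J -> R) : (forall j, Q j -> mean_le (h j) (c j)) ->
  mean_le (fun w => \sum_(j <- r | Q j) h j w) (\sum_(j <- r | Q j) c j).
Proof.
move=> hc; elim: r => [|j r ih].
  by under eq_fun do rewrite big_nil; rewrite big_nil; exact: mean_le_cst.
under eq_fun do rewrite big_cons; rewrite big_cons; case: ifP => // /hc.
by move=> hj; exact: mean_leD.
Qed.

Lemma mean_le_indic (E : set Omega) c : measurable E -> (Pr E <= c%:E)%E ->
  mean_le (\1_E) c.
Proof.
by move=> mE Ec; split => //; rewrite integral_indic// setIT.
Qed.

Lemma mean_le_dominated h h' c :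
  measurable_fun setT h -> (forall w, 0 <= h w) ->
  {ae Pr, forall w, h w <= h' w} -> mean_le h' c -> mean_le h c.
Proof.
move=> mh h0 hh' [mh' h0' hc]; split => //; apply: le_trans hc.
apply: ae_ge0_le_integral => //.
- by move=> w _; rewrite lee_fin.
- exact/measurable_EFinP.
- by move=> w _; rewrite lee_fin.
- exact/measurable_EFinP.
case: hh' => N [mN N0 sN]; exists N; split => // w /= hw; apply: sN => /= e.
by apply: hw => _; rewrite lee_fin.
Qed.

Lemma even_moment (Z : Omega -> R) (K : R) (b : nat) : (0 < b)%N -> 0 < K ->
  measurable_fun setT Z ->
  mean_le (fun w => expR (Z w ^+ 2 / K ^+ 2)) 2 ->
  mean_le (fun w => Z w ^+ (2 * b)) (2 * (b%:R ^+ b * K ^+ (2 * b))).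
Proof.
move=> b0 K0 mZ hZ.
have c0 : 0 <= b%:R ^+ b * K ^+ (2 * b) :> R.
  by rewrite mulr_ge0// exprn_ge0// ltW.
have := mean_leZ c0 hZ; rewrite [_ * 2]mulrC; apply: mean_le_dominated.
- exact: measurable_funX.
- by move=> w; rewrite exprM exprn_ge0// sqr_ge0.
apply: aeW => w /=; have := powR_even_le_exp (Z w / K) b0.
rewrite expr_div_n ler_pdivrMr ?exprn_gt0// -expr_div_n => /le_trans; apply.
by rewrite mulrAC.
Qed.

End MeanBound.

(** * Cells missed by the sample at one scale *)

Section Cells.
Context {disp : measure_display} {Omega : measurableType disp} {R : realType}.
Variable Pr : probability Omega R.
Context {d' : measure_display} {T' : measurableType d'} {I : finType}.
Variable Z : I -> Omega -> T'.
Hypotheses (mZ : forall o, measurable_fun setT (Z o))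
  (indepZ : mutually_independent Pr Z).
Variables (o0 : I) (G : {set I}).
Hypothesis sameZ : forall o, same_distribution Pr (Z o) (Z o0).
Hypotheses (o0G : o0 \notin G) (G0 : (0 < #|G|)%N).
Variables (d : nat) (U : 'I_d -> T' -> R).
Hypothesis mU : forall j, measurable_fun setT (U j).

(** The cubes of side 2^-l whose index, shifted by r in each coordinate, lies
    between 0 and 2 r: finitely many of them cover the window where every
    coordinate is below r 2^-l in absolute value. *)
Definition cell (l r : nat) (c : {ffun 'I_d -> 'I_(2 * r).+1}) : set T' :=
  [set z | forall j, (c j)%:R - r%:R <= 2 ^+ l * U j z < (c j)%:R - r%:R + 1].

Definition missed (l r : nat) (c : {ffun 'I_d -> 'I_(2 * r).+1}) : set Omega :=
  [set w | cell l c (Z o0 w) /\ forall i, i \in G -> ~ cell l c (Z i w)].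

Lemma measurable_cell (l r : nat) (c : {ffun 'I_d -> 'I_(2 * r).+1}) :
  measurable (cell l c).
Proof.
rewrite (_ : cell l c = \bigcap_(j in [set: 'I_d])
    ((fun z => 2 ^+ l * U j z) @^-1`
      [set` `[(c j)%:R - r%:R, (c j)%:R - r%:R + 1[])).
  apply: fin_bigcap_measurable => // j _; rewrite -[X in measurable X]setTI.
  by apply: measurable_funM.
apply/seteqP; split => [z h j _|z h j].
  by rewrite /= in_itv /=; exact: h.
by have := h j Logic.I; rewrite /= in_itv.
Qed.

Let box (l r : nat) (c : {ffun 'I_d -> 'I_(2 * r).+1}) (o : I) : set T' :=
  if o == o0 then cell l c else if o \in G then ~` cell l c else setT.

Let measurable_box l r c o : measurable (@box l r c o).
Proof.
rewrite /box; case: ifP => _; first exact: measurable_cell.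
by case: ifP => // _; apply: measurableC; exact: measurable_cell.
Qed.

Let missedE l r c : @missed l r c = [set w | forall o, @box l r c o (Z o w)].
Proof.
apply/seteqP; split => [w [h0 h] o|w h]; rewrite /box /=.
  case: eqP => [->//|_]; case: ifP => // oG; exact: h.
split => [|i iG]; first by have := h o0; rewrite /box eqxx.
have := h i; rewrite /box iG; case: eqP => // io; move: iG; rewrite io.
by rewrite (negbTE o0G).
Qed.

Lemma measurable_missed l r c : measurable (@missed l r c).
Proof.
rewrite missedE (_ : [set w | _] =
    \bigcap_(o in [set: I]) (Z o @^-1` box l c o)).
  apply: fin_bigcap_measurable => // o _; rewrite -[X in measurable X]setTI.
  by apply: mZ.
by apply/seteqP; split => [w h o _|w h o]; [exact: h|exact: (h o Logic.I)].
Qed.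

(** By independence the probability is a (1 - a)^n, with a the mass of the cell
    and n the number of points in G. *)
Lemma probability_missed l r c : (Pr (@missed l r c) <= (#|G|%:R^-1)%:E)%E.
Proof.
rewrite missedE (independent_setT indepZ)//.
have mC := measurable_cell l c.
have mpre (h : Omega -> T') A : measurable_fun setT h -> measurable A ->
    measurable (h @^-1` A).
  by move=> mh mA; rewrite -[X in measurable X]setTI; exact: mh.
set p := fine (Pr (Z o0 @^-1` cell l c)).
have pE : Pr (Z o0 @^-1` cell l c) = p%:E.
  by rewrite fineK// fin_num_measure//; exact: mpre.
have -> : (\prod_(o : I) Pr (Z o @^-1` box l c o) = (p * (1 - p) ^+ #|G|)%:E)%E.
  rewrite (bigD1 o0)//= /box eqxx pE EFinM; congr (_ * _)%E.
  rewrite (bigID (mem G))/= [X in (_ * X)%E]big1 ?mule1; last first.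
    move=> o /andP[/negbTE -> /negbTE ->].
    by rewrite preimage_setT probability_setT.
  transitivity (\prod_(o in G) (1 - p)%:E)%E.
    rewrite (eq_bigl (fun o => o \in G)); last first.
      move=> o; rewrite /= andb_idl// => oG; apply: contraNneq o0G => <-.
      exact: oG.
    apply: eq_bigr => o oG; rewrite ifN; last by apply: contraNneq o0G => <-.
    rewrite ifT// -preimage_setC probability_setC; last exact: mpre.
    by rewrite [X in (_ - X)%E](sameZ o mC) pE.
  by rewrite prodEFin prodr_const.
rewrite lee_fin; apply: missed_cell_le => //; rewrite -!lee_fin -pE.
by rewrite measure_ge0 probability_le1//; exact: mpre.
Qed.

(** The first sum is at least 1 when the query leaves the window of radius rad;
    being a sum of even moments, it has Markov's bound as its mean. The second
    sum is 1 when the cell of the query in the window is missed. *)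
Definition miss_bound (l r b : nat) (rad : R) (w : Omega) : R :=
  \sum_(j < d) (U j (Z o0 w) / rad) ^+ (2 * b) +
  \sum_(c : {ffun 'I_d -> 'I_(2 * r).+1}) \1_(missed l c) w.

Lemma miss_bound_ge0 l r b rad w : 0 <= miss_bound l r b rad w.
Proof.
by apply: addr_ge0; apply: sumr_ge0 => j _ //; rewrite exprM exprn_ge0// sqr_ge0.
Qed.

Lemma near_or_missed (l r b : nat) (rad : R) (w : Omega) :
  0 < rad -> 2 ^+ l * rad <= r%:R ->
  (exists2 i, i \in G &
     forall j, `|U j (Z i w) - U j (Z o0 w)| <= (2 ^+ l)^-1) \/
  1 <= miss_bound l r b rad w.
Proof.
move=> rad0 radr; have p2 : 0 < 2 ^+ l :> R by rewrite exprn_gt0.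
have S0 : 0 <= \sum_(j < d) (U j (Z o0 w) / rad) ^+ (2 * b).
  by apply: sumr_ge0 => j _; rewrite exprM exprn_ge0// sqr_ge0.
have S1 : 0 <= \sum_(c : {ffun 'I_d -> 'I_(2 * r).+1}) \1_(missed l c) w :> R.
  by apply: sumr_ge0.
have [/forallP Ule|] := boolP [forall j, `|U j (Z o0 w)| < rad]; last first.
  rewrite negb_forall => /existsP[j]; rewrite -leNgt => Uj; right.
  rewrite /miss_bound (bigD1 j)//= -!addrA; apply: ler_wpDr.
    rewrite addr_ge0//; apply: sumr_ge0 => i _.
    by rewrite exprM exprn_ge0// sqr_ge0.
  rewrite exprM exprn_ege1// -real_normK ?num_real// exprn_ege1//.
  by rewrite normrM normfV [`|rad|]gtr0_norm// ler_pdivlMr// mul1r.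
have bd j : - r%:R < 2 ^+ l * U j (Z o0 w) < r%:R.
  have := Ule j; rewrite ltr_norml => /andP[U1 U2].
  by rewrite -(ltr_pM2l p2) in U1; rewrite -(ltr_pM2l p2) in U2; lra.
have ge j : 0 <= 2 ^+ l * U j (Z o0 w) + r%:R by have /andP[] := bd j; lra.
have tb j : (Num.truncn (2 ^+ l * U j (Z o0 w) + r%:R) < (2 * r).+1)%N.
  rewrite truncn_lt_nat//.
  have -> : (2 * r).+1%:R = r%:R + r%:R + 1 :> R.
    by rewrite -[LHS]natr1 mul2n -addnn natrD.
  by have /andP[] := bd j; lra.
pose c := [ffun j => Ordinal (tb j)].
have Cw : cell l c (Z o0 w).
  move=> j; rewrite ffunE /=; have := truncn_itv (ge j).
  by rewrite -natr1; lra.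
have [[i iG Ci]|noi] := pselect (exists2 i, i \in G & cell l c (Z i w)).
  left; exists i => // j.
  have /andP[a1 a2] := Cw j; have /andP[b1 b2] := Ci j.
  rewrite -(ler_pM2l p2) mulfV ?gt_eqF// -[X in X * _](gtr0_norm p2) -normrM.
  by rewrite mulrBr ler_norml; lra.
right; rewrite /miss_bound (bigD1 c)//= addrCA; apply: ler_wpDr.
  by rewrite addr_ge0//; apply: sumr_ge0.
rewrite indicE mem_set//; split => // i iG Ci; apply: noi; by exists i.
Qed.

Lemma mean_miss_bound (l r b : nat) (rad K : R) :
  (0 < b)%N -> 0 < rad -> 0 < K ->
  (forall j, mean_le Pr (fun w => expR (U j (Z o0 w) ^+ 2 / K ^+ 2)) 2) ->
  mean_le Pr (miss_bound l r b rad)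
    (d%:R * (2 * (b%:R ^+ b * K ^+ (2 * b)) / rad ^+ (2 * b)) +
     (2 * r).+1%:R ^+ d / #|G|%:R).
Proof.
move=> b0 rad0 K0 hU; apply: mean_leD.
  have := mean_le_sum (index_enum 'I_d) (Q := xpredT)
    (h := fun j w => (U j (Z o0 w) / rad) ^+ (2 * b))
    (c := fun _ => 2 * (b%:R ^+ b * K ^+ (2 * b)) / rad ^+ (2 * b)) (Pr := Pr).
  rewrite sumr_const card_ord -[X in mean_le _ _ X]mulr_natl; apply => j _.
  have r0 : 0 <= (rad ^+ (2 * b))^-1 by rewrite invr_ge0 exprn_ge0// ltW.
  have := mean_leZ r0 (even_moment b0 K0 (measurableT_comp (mU j) (mZ o0)) (hU j)).
  rewrite [X in mean_le _ _ X]mulrC; apply: mean_le_dominated.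
  - apply: measurable_funX; apply: measurable_funM => //.
    exact: measurableT_comp.
  - by move=> w; rewrite exprM exprn_ge0// sqr_ge0.
  - by apply: aeW => w /=; rewrite exprMn exprVn mulrC.
have := mean_le_sum (index_enum {ffun 'I_d -> 'I_(2 * r).+1}) (Q := xpredT)
    (h := fun c => \1_(missed l c)) (c := fun _ => #|G|%:R^-1) (Pr := Pr).
rewrite sumr_const card_ffun !card_ord -[X in mean_le _ _ X]mulr_natl natrX.
apply => c _.
by apply: mean_le_indic; [exact: measurable_missed|exact: probability_missed].
Qed.

End Cells.

(** * Nearest neighbours over all scales *)

Section Multiscale.
Context {disp : measure_display} {Omega : measurableType disp} {R : realType}.
Variable Pr : probability Omega R.
Context {d' : measure_display} {T' : measurableType d'} {I : finType}.
Variable Z : I -> Omega -> T'.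
Hypotheses (mZ : forall o, measurable_fun setT (Z o))
  (indepZ : mutually_independent Pr Z).
Variables (o0 : I) (G : {set I}).
Hypothesis sameZ : forall o, same_distribution Pr (Z o) (Z o0).
Hypotheses (o0G : o0 \notin G) (G0 : (0 < #|G|)%N).
Variables (d : nat) (U : 'I_d -> T' -> R).
Hypothesis mU : forall j, measurable_fun setT (U j).
Hypothesis d0 : (0 < d)%N.

Definition gap (i : I) (w : Omega) : R :=
  \sum_(j < d) `|U j (Z i w) - U j (Z o0 w)|.

Lemma gap_ge0 i w : 0 <= gap i w. Proof. exact: sumr_ge0. Qed.

Variable b : nat.

(** The number of points of G per cell of side 2^-l, if they were spread evenly
    over the unit cube. *)
Definition level_size (l : nat) : R := #|G|%:R / 2 ^+ (l * d).
(** The exponent is chosen so that radius^d / size = size^-g: the number of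
    cells in the window, divided by the number of points, is of the order
    wanted for the probability of a miss. *)
Definition level_radius (g : R) (l : nat) : R :=
  level_size l `^ ((1 - g) / d%:R).
Definition level_grid (g : R) (l : nat) : nat :=
  (Num.truncn (2 ^+ l * level_radius g l)).+1.
Definition level_miss (g : R) (l : nat) (w : Omega) : R :=
  miss_bound Z o0 G U l (level_grid g l) b (level_radius g l) w.

Lemma level_size_gt0 l : 0 < level_size l.
Proof. by rewrite divr_gt0 ?ltr0n// exprn_gt0. Qed.

Lemma near_or_level_miss g l w :
  (exists2 i, i \in G & gap i w <= d%:R * 2 ^- l) \/ 1 <= level_miss g l w.
Proof.
have rad0 : 0 < level_radius g l by rewrite powR_gt0// level_size_gt0.
have radr : 2 ^+ l * level_radius g l <= (level_grid g l)%:R.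
  apply: ltW; have p0 : 0 <= 2 ^+ l * level_radius g l.
    by rewrite mulr_ge0 ?powR_ge0// exprn_ge0.
  by have /andP[] := truncn_itv p0.
have [[i iG h]|] := near_or_missed Z o0 G U b w rad0 radr; [left|by right].
exists i => //; apply: (@le_trans _ _ (\sum_(j < d) 2 ^- l)).
  by apply: ler_sum => j _; exact: h.
by rewrite sumr_const card_ord -[leLHS]mulr_natl.
Qed.

(** The window has at most (5 2^l radius)^d cells, each missed with probability
    at most 1 / n, and (2^l radius)^d / n = size^-g. The tail costs
    radius^-2b <= size^-g as soon as the order 2 b of the moment is large. *)
Lemma mean_level_miss (g K : R) (l : nat) : 0 < g < 1 -> (0 < b)%N -> 0 < K ->
  g <= (1 - g) / d%:R * (2 * b)%:R ->
  (forall j, mean_le Pr (fun w => expR (U j (Z o0 w) ^+ 2 / K ^+ 2)) 2) ->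
  1 <= level_size l ->
  mean_le Pr (level_miss g l)
    ((5 ^+ d + d%:R * (2 * (b%:R ^+ b * K ^+ (2 * b)))) *
      level_size l `^ (- g)).
Proof.
move=> /andP[g0 g1] b0 K0 gb hU s1.
set lam := level_size l in s1 *.
have lam0 : 0 < lam by exact: level_size_gt0.
have dp : 0 < d%:R :> R by rewrite ltr0n.
set rad := level_radius g l.
have rad1 : 1 <= rad.
  rewrite -(powRr0 lam); apply: ler_powR => //.
  by rewrite divr_ge0// subr_ge0 ltW.
have rad0 : 0 < rad by apply: lt_le_trans rad1.
have := mean_miss_bound mZ indepZ sameZ o0G G0 mU l (level_grid g l) b0 rad0 K0 hU.
apply: mean_le_trans; rewrite [leRHS]mulrDl addrC; apply: lerD.
  have two1 : 1 <= 2 ^+ l * rad :> R.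
    by rewrite -[leLHS]mulr1 ler_pM// exprn_ege1// ler1n.
  have grid5 : (2 * level_grid g l).+1%:R <= 5 * (2 ^+ l * rad) :> R.
    have /andP[+ _] : ((Num.truncn (2 ^+ l * rad))%:R <= 2 ^+ l * rad
        < (Num.truncn (2 ^+ l * rad)).+1%:R) by apply: truncn_itv; lra.
    rewrite /level_grid -/rad; set t := Num.truncn _.
    have -> : (2 * t.+1).+1%:R = 2 * t%:R + 3 :> R.
      by rewrite -natr1 natrM -natr1; ring.
    by lra.
  rewrite ler_pdivrMr ?ltr0n//.
  apply: (@le_trans _ _ ((5 * (2 ^+ l * rad)) ^+ d)).
    by apply: lerXn2r; rewrite ?nnegrE//; lra.
  have radd : rad ^+ d = lam `^ (1 - g).
    rewrite -powR_mulrn ?(ltW rad0)// /rad /level_radius -powRrM.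
    by rewrite divfK// gt_eqF.
  rewrite !exprMn radd -exprM powRB ?gt_eqF ?implybT// powRr1 ?(ltW lam0)//.
  rewrite powRN /lam /level_size; set q := (_ `^ g)^-1.
  rewrite le_eqVlt; apply/orP; left; apply/eqP.
  by field; rewrite gt_eqF// exprn_gt0.
rewrite -[leRHS]mulrA ler_wpM2l ?(ltW dp)// ler_wpM2l//.
  by rewrite mulr_ge0// mulr_ge0// exprn_ge0// ltW.
rewrite powRN lef_pV2 ?posrE ?exprn_gt0 ?powR_gt0//.
rewrite -powR_mulrn ?(ltW rad0)// /rad /level_radius -powRrM.
exact: ler_powR.
Qed.

(** Let m be the finest scale, up to M, at which some neighbour in G shares the
    cell of the query. Either m = M, or level m + 1 is missed and the gap is at
    most d 2^-m. If there is no such scale, level 0 is missed, and the gap of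
    an arbitrary point is cut at tau:
    gap^p <= tau^p + tau^(p - q) gap^q. *)
Lemma gap_le_multiscale (g p tau : R) (q M : nat) (i0 : I) (w : Omega) :
  0 <= p -> p <= q%:R -> 0 < tau -> i0 \in G ->
  exists2 i, i \in G & gap i w `^ p <=
    d%:R `^ p * (2 `^ (- p)) ^+ M
    + \sum_(l < M) d%:R `^ p * (2 `^ (- p)) ^+ l * level_miss g l.+1 w
    + (tau `^ p * level_miss g 0 w + tau `^ (p - q%:R) * gap i0 w ^+ q).
Proof.
move=> p0 pq tau0 i0G.
have nearp l i : gap i w <= d%:R * 2 ^- l ->
    gap i w `^ p <= d%:R `^ p * (2 `^ (- p)) ^+ l.
  move=> h; apply: (@le_trans _ _ ((d%:R * 2 ^- l) `^ p)).
    apply: ge0_ler_powR => //;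
      by rewrite ?nnegrE ?gap_ge0// mulr_ge0// invr_ge0 exprn_ge0.
  rewrite powRM// ?invr_ge0 ?exprn_ge0//.
  rewrite -(@powR_invn _ 2)// -[(_ `^ (- p)) ^+ l]powR_mulrn ?powR_ge0//.
  by rewrite -!powRrM [- l%:R * p]mulNr [- p * l%:R]mulNr [p * _]mulrC.
have miss0 l : 0 <= level_miss g l w by exact: miss_bound_ge0.
have C0 l : 0 <= d%:R `^ p * (2 `^ (- p)) ^+ l.
  by rewrite mulr_ge0 ?powR_ge0// exprn_ge0// powR_ge0.
have rest0 : 0 <= tau `^ p * level_miss g 0 w + tau `^ (p - q%:R) * gap i0 w ^+ q.
  by rewrite addr_ge0// mulr_ge0 ?powR_ge0// exprn_ge0// gap_ge0.
elim: M => [|M [i iG ih]].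
  rewrite big_ord0 addr0 expr0 mulr1.
  have [[i iG h]|h] := near_or_level_miss g 0 w.
    exists i => //; apply: ler_wpDr => //.
    by have := nearp _ _ h; rewrite expr0 mulr1.
  exists i0 => //; apply: ler_wpDl; first exact: powR_ge0.
  have [gt|tg] := leP (gap i0 w) tau.
    apply: ler_wpDr; first by rewrite mulr_ge0 ?powR_ge0// exprn_ge0// gap_ge0.
    apply: (@le_trans _ _ (tau `^ p)); last by rewrite ler_peMr// powR_ge0.
    by apply: ge0_ler_powR; rewrite ?nnegrE ?gap_ge0// ltW.
  apply: ler_wpDl; first by rewrite mulr_ge0 ?powR_ge0.
  have gp : 0 < gap i0 w by apply: lt_trans tg.
  have -> : gap i0 w ^+ q = gap i0 w `^ (q%:R - p) * gap i0 w `^ p.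
    rewrite -powRD ?subrK ?powR_mulrn ?gap_ge0//.
    by rewrite (gt_eqF gp) implybT.
  rewrite -opprB powRN mulrA ler_peMl ?powR_ge0// mulrC ler_pdivlMr ?powR_gt0//.
  rewrite mul1r; apply: ge0_ler_powR; rewrite ?nnegrE ?subr_ge0// ?ltW//.
have [[i' i'G h]|h] := near_or_level_miss g M.+1 w.
  exists i' => //; rewrite -addrA; apply: ler_wpDr; last exact: nearp.
  by rewrite addr_ge0// sumr_ge0// => l _; exact: mulr_ge0.
exists i => //; apply: (le_trans ih); rewrite lerD2r big_ord_recr /=.
rewrite addrCA -[leLHS]addrC lerD2l; apply: ler_wpDl; first exact: C0.
by rewrite ler_peMr.
Qed.

Lemma mean_gap_pow (K : R) (c : nat) (i : I) : (0 < c)%N -> 0 < K ->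
  (forall o j, mean_le Pr (fun w => expR (U j (Z o w) ^+ 2 / K ^+ 2)) 2) ->
  mean_le Pr (fun w => gap i w ^+ (2 * c))
    ((d + d)%:R ^+ (2 * c) * ((d + d)%:R * (2 * (c%:R ^+ c * K ^+ (2 * c))))).
Proof.
move=> c0 K0 hU.
have dd0 : 0 <= (d + d)%:R ^+ (2 * c) :> R by rewrite exprn_ge0.
pose u (e : bool * 'I_d) w := U e.2 (Z (if e.1 then i else o0) w).
have hu e : mean_le Pr (fun w => u e w ^+ (2 * c)) (2 * (c%:R ^+ c * K ^+ (2 * c))).
  apply: even_moment => //; [exact: measurableT_comp|exact: hU].
have := mean_leZ dd0 (mean_le_sum (index_enum _) (Q := xpredT) (fun e _ => hu e)).
have cbd : #|{: bool * 'I_d}| = (d + d)%N.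
  by rewrite card_prod card_bool card_ord mul2n addnn.
rewrite sumr_const cbd -[X in _ * X]mulr_natl; apply: mean_le_dominated.
- apply: measurable_funX; apply: measurable_sum => j.
  apply: measurableT_comp; first exact: normr_measurable.
  by apply: measurable_funB; exact: measurableT_comp.
- by move=> w; rewrite exprn_ge0// gap_ge0.
apply: aeW => w.
have gle : gap i w <= \sum_(e : bool * 'I_d) `|u e w|.
  rewrite -(pair_big xpredT xpredT (fun a j => `|u (a, j) w|)) /=.
  rewrite big_bool /= -big_split /=; apply: ler_sum => j _.
  exact: ler_normB.
apply: (@le_trans _ _ ((\sum_(e : bool * 'I_d) `|u e w|) ^+ (2 * c))).
  by apply: lerXn2r; rewrite ?nnegrE ?gap_ge0 ?sumr_ge0.
rewrite -cbd; apply: le_trans (sum_pow_le _ _ _) _ => //.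
  by rewrite cbd addn_gt0 d0.
rewrite ler_wpM2l// ?cbd//; apply: ler_sum => e _.
by rewrite !exprM real_normK ?num_real.
Qed.

End Multiscale.

(** * The nearest-neighbour rate *)

Section Rate.
Variable R : realType.

Lemma exists_natr_ge (a x : R) : 0 < a ->
  exists2 n : nat, (0 < n)%N & x <= a * n%:R.
Proof.
move=> a0; exists (Num.truncn `|x / a|).+1 => //.
rewrite -ler_pdivrMl// mulrC; apply: (le_trans (ler_norm _)).
by have /andP[_ /ltW] := truncn_itv (normr_ge0 (x / a)).
Qed.

Lemma geometric_sum_le (x : R) (M : nat) : 1 < x ->
  \sum_(l < M) x ^+ l <= x ^+ M / (x - 1).
Proof.
move=> x1; rewrite ler_pdivlMr ?subr_gt0// mulrC -subrX1.
by rewrite lerBlDr lerDl.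
Qed.

(** The constant C must serve every probability space and sample at once, hence
    the quantification over all of them inside the property. *)
Definition is_nn_rate (d : nat) (p K C : R) : Prop :=
  forall (disp : measure_display) (Omega : measurableType disp)
    (Pr : probability Omega R) (d' : measure_display) (T' : measurableType d')
    (I : finType) (Z : I -> Omega -> T') (o0 : I) (G : {set I})
    (U : 'I_d -> T' -> R),
  (forall o, measurable_fun setT (Z o)) -> mutually_independent Pr Z ->
  (forall o, same_distribution Pr (Z o) (Z o0)) ->
  o0 \notin G -> (0 < #|G|)%N -> (forall j, measurable_fun setT (U j)) ->
  (forall o j, mean_le Pr (fun w => expR (U j (Z o w) ^+ 2 / K ^+ 2)) 2) ->
  exists2 Phi : Omega -> R, mean_le Pr Phi (C * #|G|%:R `^ (- (p / d%:R))) &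
    forall w, exists2 i, i \in G & gap Z o0 U i w `^ p <= Phi w.

(** With e = p / d < g < 1 and M such that 2^(M d) <= n < 2^((M + 1) d), the
    term of level l in the multiscale bound has mean of order n^-g beta^l with
    beta = 2^(d (g - e)) > 1, so the geometric sum is of order
    n^-g 2^(M d (g - e)) <= n^-e. At level 0 the cut tau = n^delta with
    delta p = g - e gives tau^p n^-g = n^-e, and the remaining term
    tau^(p - 2 c) is at most n^-e once c is large. *)
Lemma nearest_neighbour_rate (d : nat) (p K : R) : 0 < p < d%:R -> 0 < K ->
  exists2 C : R, 0 <= C & is_nn_rate d p K C.
Proof.
move=> /andP[p0 pd] K0.
have dp : 0 < d%:R :> R by apply: lt_trans pd.
have d0 : (0 < d)%N by rewrite -(ltr0n R).
pose e := p / d%:R.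
have e0 : 0 < e by rewrite divr_gt0.
have e1 : e < 1 by rewrite ltr_pdivrMr// mul1r.
pose g := (1 + e) / 2.
have g01 : 0 < g < 1 by rewrite /g; apply/andP; split; lra.
have eg : e < g by rewrite /g; lra.
have ge0 : 0 < g - e by rewrite subr_gt0.
have g1d : 0 < (1 - g) / d%:R * 2.
  by rewrite mulr_gt0// divr_gt0// subr_gt0; case/andP: g01.
have [b b0 gb] := exists_natr_ge g g1d.
pose delta := (g - e) / p.
have delta0 : 0 < delta by rewrite divr_gt0.
have delta2 : 0 < delta * 2 by rewrite mulr_gt0.
have [c c0 ec] := exists_natr_ge (e + delta * p) delta2.
pose D0 : R := d%:R `^ p.
pose theta : R := 2 `^ (- p).
pose kappa : R := 2 `^ (d%:R * g).
pose beta := theta * kappa.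
have theta0 : 0 < theta by rewrite powR_gt0.
have kappa0 : 0 < kappa by rewrite powR_gt0.
have betaE : beta = 2 `^ (d%:R * (g - e)).
  rewrite /beta /theta /kappa -powRD ?pnatr_eq0 ?implybT//; congr (_ `^ _).
  by rewrite /e; field; rewrite gt_eqF.
have beta1 : 1 < beta.
  rewrite betaE; have x0 : 0 < d%:R * (g - e) by rewrite mulr_gt0.
  have := @gt0_ltr_powR _ _ x0 1 2; rewrite powR1; apply; rewrite ?nnegrE//.
  by rewrite ltr1n.
pose CE := 5 ^+ d + d%:R * (2 * (b%:R ^+ b * K ^+ (2 * b))) : R.
pose CY := (d + d)%:R ^+ (2 * c) *
  ((d + d)%:R * (2 * (c%:R ^+ c * K ^+ (2 * c)))) : R.
have CE0 : 0 <= CE.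
  by rewrite addr_ge0 ?exprn_ge0// !mulr_ge0// exprn_ge0// ltW.
have CY0 : 0 <= CY by rewrite !mulr_ge0 ?exprn_ge0// ltW.
have D00 : 0 <= D0 by exact: powR_ge0.
exists (D0 * 2 `^ p + D0 * CE * kappa / (beta - 1) + CE + CY).
  have b0' : 0 <= (beta - 1)^-1 by rewrite invr_ge0 subr_ge0 ltW.
  apply: addr_ge0 => //; apply: addr_ge0 => //; apply: addr_ge0.
    by rewrite mulr_ge0// powR_ge0.
  exact: mulr_ge0 (mulr_ge0 (mulr_ge0 D00 CE0) (ltW kappa0)) b0'.
move=> disp Omega Pr d' T' I Z o0 G U mZ indepZ sameZ o0G G0 mU hU.
set n : R := #|G|%:R; set rho := n `^ _.
have n1 : 1 <= n by rewrite ler1n.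
have n0 : 0 < n by apply: lt_le_trans n1.
have [i0 i0G] : exists i, i \in G by apply/card_gt0P.
have pq : p <= (2 * c)%:R.
  rewrite natrM -(ler_pM2l delta0) mulrA; apply: le_trans ec.
  by rewrite lerDr ltW.
pose M := trunc_log (2 ^ d) #|G|.
have d21 : (1 < 2 ^ d)%N by rewrite -{1}(expn0 2) ltn_exp2l.
have Mle l : (l <= M)%N -> 2 ^+ (l * d) <= n.
  move=> lM; apply: (@le_trans _ _ (2 ^+ (M * d))).
    by apply: ler_weXn2l; rewrite ?ler1n// leq_mul2r lM orbT.
  by rewrite -natrX ler_nat mulnC expnM trunc_logP.
have Mgt : n <= 2 ^+ (M.+1 * d).
  by rewrite -natrX ler_nat mulnC expnM ltnW// trunc_log_ltn.
pose tau := n `^ delta.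
have tau0 : 0 < tau by rewrite powR_gt0.
have two_pow (a : R) (l : nat) : (2 `^ a) ^+ l = (2 ^+ (l * d)) `^ (a / d%:R).
  rewrite -powR_mulrn ?powR_ge0// -[2 ^+ (l * d)]powR_mulrn// -!powRrM natrM.
  by congr (_ `^ _); field; rewrite gt_eqF.
exists (fun w => D0 * theta ^+ M
    + \sum_(l < M) D0 * theta ^+ l * level_miss Z o0 G U b g l.+1 w
    + (tau `^ p * level_miss Z o0 G U b g 0 w +
       tau `^ (p - (2 * c)%:R) * gap Z o0 U i0 w ^+ (2 * c))); last first.
  by move=> w; apply: gap_le_multiscale => //; exact: ltW.
have mean_miss l : (l <= M)%N ->
    mean_le Pr (level_miss Z o0 G U b g l) (CE * level_size G d l `^ (- g)).
  move=> lM; apply: mean_level_miss => //.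
    by rewrite natrM mulrA.
  by rewrite /level_size ler_pdivlMr ?exprn_gt0// mul1r; exact: Mle.
have theta_M : theta ^+ M <= 2 `^ p * rho.
  rewrite -(ler_pM2l theta0) -exprS mulrA -powRD ?pnatr_eq0 ?implybT//.
  rewrite addNr powRr0 mul1r /theta two_pow mulNr /rho -/e !powRN.
  rewrite lef_pV2 ?posrE ?powR_gt0 ?exprn_gt0//.
  by apply: ge0_ler_powR; rewrite ?nnegrE ?(ltW e0) ?(ltW n0)// exprn_ge0.
have miss_term (l : nat) : (l < M)%N ->
    mean_le Pr (fun w => D0 * theta ^+ l * level_miss Z o0 G U b g l.+1 w)
      (D0 * CE * kappa * n `^ (- g) * beta ^+ l).
  move=> lM.
  have c00 : 0 <= D0 * theta ^+ l by rewrite mulr_ge0// exprn_ge0// ltW.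
  have := mean_leZ c00 (mean_miss _ lM); apply: mean_le_trans.
  have -> : level_size G d l.+1 `^ (- g) = n `^ (- g) * kappa ^+ l.+1.
    rewrite /level_size powRM ?invr_ge0 ?exprn_ge0 ?ltW//; congr (_ * _).
    rewrite /kappa two_pow mulrAC mulfV ?gt_eqF// mul1r.
    by rewrite -powR_inv1 ?exprn_ge0// -powRrM mulrNN mul1r.
  by rewrite /beta exprMn exprS le_eqVlt; apply/orP; left; apply/eqP; ring.
have := mean_leD (mean_leD (mean_le_cst Pr _) (mean_le_sum (index_enum 'I_M)
    (Q := xpredT) (fun l _ => miss_term l (ltn_ord l))))
  (mean_leD (mean_leZ (powR_ge0 tau p) (mean_miss 0 (leq0n _)))
    (mean_leZ (powR_ge0 tau (p - (2 * c)%:R))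
       (mean_gap_pow mZ o0 mU d0 i0 c0 K0 hU))).
move=> /(_ _ (mulr_ge0 D00 (exprn_ge0 M (ltW theta0)))).
apply: mean_le_trans.
rewrite -/CY; clearbody CE CY; rewrite -mulr_sumr !mulrDl -[leRHS]addrA.
apply: lerD; apply: lerD.
- by rewrite -[leRHS]mulrA ler_wpM2l.
- have c0' : 0 <= D0 * CE * kappa by rewrite !mulr_ge0// ltW.
  have -> : D0 * CE * kappa / (beta - 1) * rho =
      D0 * CE * kappa * (rho / (beta - 1)) by ring.
  rewrite -[leLHS]mulrA ler_wpM2l//.
  apply: (@le_trans _ _ (n `^ (- g) * (beta ^+ M / (beta - 1)))).
    by rewrite ler_wpM2l ?powR_ge0// geometric_sum_le.
  rewrite mulrA ler_wpM2r//; first by rewrite invr_ge0 subr_ge0 ltW.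
  rewrite betaE two_pow mulrAC mulfV ?gt_eqF// mul1r.
  apply: (@le_trans _ _ (n `^ (- g) * n `^ (g - e))).
    rewrite ler_wpM2l ?powR_ge0//.
    by apply: ge0_ler_powR;
      rewrite ?nnegrE ?(ltW ge0) ?(ltW n0) ?exprn_ge0 ?Mle.
  by rewrite -powRD ?(gt_eqF n0) ?implybT// addrA addNr add0r.
- rewrite /level_size mul0n expr0 divr1 mulrCA ler_wpM2l//.
  rewrite /tau -powRrM -powRD ?(gt_eqF n0) ?implybT// /delta divfK ?gt_eqF//.
  by rewrite addrAC subrr add0r.
- rewrite mulrC ler_wpM2l// /tau -powRrM; apply: ler_powR => //.
  by rewrite mulrBr -/e natrM; lra.
Qed.

End Rate.

(** * Borel measurability, sub-Gaussian moments, order statistics *)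

Section Borel.
Variable R : realType.

Lemma open_superlevel_measurable (n : nat) (h : 'cV[R]_n -> R) :
  (forall a, open [set x | a < h x]) -> measurable_fun setT h.
Proof.
move=> oh; apply: (measurability _ (RGenOInfty.measurableE R)) => //.
move=> _ [_ [a ->] <-]; rewrite setTI; apply: sub_sigma_algebra.
rewrite (_ : h @^-1` _ = [set x | a < h x])//.
by apply/seteqP; split => x /=; rewrite in_itv/= andbT.
Qed.

Lemma measurable_entry (n : nat) (i : 'I_n) :
  measurable_fun setT (fun x : 'cV[R]_n => x i 0).
Proof.
apply: open_superlevel_measurable => a.
have := @coord_continuous R n 1 i 0.
move=> /continuousP/(_ _ (@open_gt _ a)).
by [].
Qed.

Lemma measurable_dot (n : nat) (u : 'cV[R]_n) : measurable_fun setT (dot u).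
Proof.
apply: measurable_sum => i; apply: measurable_funM => //.
exact: measurable_entry.
Qed.

(** The Borel sets of column vectors are generated by the open sets, so
    continuity is what is needed, and it follows from the Hoelder bound since
    A^T does not increase the norm. *)
Lemma holder_measurable (m n : nat) (A : 'M[R]_(m, n)) (g : 'cV[R]_n -> R)
    (L s : R) : orthonormal_columns A -> 0 < s ->
  (forall z z', `|g z - g z'| <= L * enorm (z - z') `^ s) ->
  measurable_fun setT (fun x : 'cV[R]_m => g (A^T *m x)).
Proof.
move=> AA s0 gH; apply: open_superlevel_measurable => a.
rewrite openE => x /= ax; apply/nbhs_ballP.
pose e := g (A^T *m x) - a.
have e0 : 0 < e by rewrite subr_gt0.
pose t := (e / (`|L| + 1)) `^ s^-1.
have L0 : 0 < `|L| + 1 by rewrite ltr_wpDl.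
have t0 : 0 < t by rewrite powR_gt0// divr_gt0.
exists (t / m.+1%:R) => /=; first by rewrite divr_gt0.
move=> y [_ xy].
have nxy : enorm (x - y) <= t.
  apply: (le_trans (enorm_le_sum _)).
  apply: (@le_trans _ _ (\sum_(i < m) t / m.+1%:R)).
    by apply: ler_sum => i _; rewrite !mxE ltW//; have := xy i 0.
  rewrite sumr_const card_ord -[leLHS]mulr_natr -mulrA ler_piMr ?(ltW t0)//.
  by rewrite mulrC ler_pdivrMr// mul1r ler_nat.
have : `|g (A^T *m x) - g (A^T *m y)| < e.
  apply: (le_lt_trans (gH _ _)); rewrite -mulmxBr.
  apply: (@le_lt_trans _ _ (`|L| * t `^ s)).
    apply: (le_trans (ler_wpM2r (powR_ge0 _ _) (ler_norm L))).
    rewrite ler_wpM2l//.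
    apply: ge0_ler_powR; rewrite ?nnegrE ?enorm_ge0 ?(ltW s0) ?(ltW t0)//.
    exact: le_trans (enorm_trmx_orthonormal_le _ AA) nxy.
  rewrite /t -powRrM mulVf ?gt_eqF// powRr1; last by rewrite divr_ge0 ?ltW.
  rewrite mulrA ltr_pdivrMr// mulrC ltr_pM2l// ltrDl//.
by rewrite /= ltr_norml /e; lra.
Qed.

End Borel.

Section SubGaussian.
Context {disp : measure_display} {Omega : measurableType disp} {R : realType}.
Variable Pr : probability Omega R.

Lemma psi2_exp_moment (h : Omega -> R) (K : R) : measurable_fun setT h ->
  (psi2_norm Pr h < K%:E)%E ->
  mean_le Pr (fun w => expR (h w ^+ 2 / K ^+ 2)) 2.
Proof.
move=> mh /ereal_inf_lt[_ [t [t0 ht] <-]]; rewrite lte_fin => tK.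
have mexp (c : R) : measurable_fun setT (fun w => expR (h w ^+ 2 / c ^+ 2)).
  apply: measurableT_comp; first exact: measurable_expR.
  by apply: measurable_funM => //; exact: measurable_funX.
split; [exact: mexp|by move=> w; exact: expR_ge0|].
rewrite unlock in ht; apply: le_trans ht; apply: ge0_le_integral => //.
- exact/measurable_EFinP.
- exact/measurable_EFinP.
- move=> w _; rewrite lee_fin ler_expR ler_wpM2l ?sqr_ge0//.
  rewrite lef_pV2 ?posrE ?exprn_gt0//; last exact: lt_trans tK.
  by apply: lerXn2r; rewrite ?nnegrE ltW// (lt_trans t0).
Qed.

Lemma psi2_norm_ge0 (h : Omega -> R) : (0 <= psi2_norm Pr h)%E.
Proof.
by apply: le_ereal_inf_tmp => _ [t [t0 _] <-]; rewrite lee_fin ltW.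
Qed.

Variables (n : nat) (X : Omega -> 'cV[R]_n).
Hypotheses (mX : measurable_fun setT X) (sgX : sub_gaussian Pr X).
Let K : R := fine (psi2_norm_vec Pr X).

Lemma psi2_norm_direction (u : 'cV[R]_n) : enorm u = 1 ->
  (psi2_norm Pr (fun w => dot u (X w)) <= K%:E)%E.
Proof.
move=> u1.
have le : (psi2_norm Pr (fun w => dot u (X w)) <= psi2_norm_vec Pr X)%E.
  apply: ereal_sup_ubound; exists u => //=; congr (psi2_norm Pr _).
  by apply/funext => w; rewrite mxE; apply: eq_bigr => i _; rewrite mxE.
rewrite fineK// fin_numE; apply/andP; split; last by rewrite lt_eqF.
by rewrite gt_eqF// (lt_le_trans _ le)// (lt_le_trans _ (psi2_norm_ge0 _)).
Qed.

Lemma psi2_norm_vec_ge0 : (0 < n)%N -> 0 <= K.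
Proof.
case: n X @K mX sgX psi2_norm_direction => // n' X' K' _ _ h _.
have d1 : enorm (delta_mx ord0 0 : 'cV[R]_n'.+1) = 1.
  rewrite /enorm (bigD1 ord0)//= big1 ?addr0; last first.
    by move=> i i0; rewrite mxE (negbTE i0) expr0n.
  by rewrite mxE !eqxx expr1n sqrtr1.
by have := h _ d1; rewrite -lee_fin; apply: le_trans; exact: psi2_norm_ge0.
Qed.

(** A number kappa strictly above the norm is used because an infimum need not
    be attained by an admissible t; enlarging t only lowers the exponential
    moment. *)
Lemma exp_moment_direction (u : 'cV[R]_n) (kappa : R) : enorm u <= 1 ->
  K < kappa -> mean_le Pr (fun w => expR (dot u (X w) ^+ 2 / kappa ^+ 2)) 2.
Proof.
move=> u1 Kk.
have mdot (v : 'cV[R]_n) : measurable_fun setT (fun w => dot v (X w)).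
  by apply: measurableT_comp => //; exact: measurable_dot.
have mexp : measurable_fun setT (fun w => expR (dot u (X w) ^+ 2 / kappa ^+ 2)).
  apply: measurableT_comp; first exact: measurable_expR.
  by apply: measurable_funM => //; exact: measurable_funX.
have [u0|u0] := eqVneq (enorm u) 0.
  have h1 : mean_le Pr (cst (1 : R)) 2.
    by apply: (mean_le_trans (ler1n _ 2)); exact: mean_le_cst.
  apply: mean_le_dominated h1 => //; apply: aeW => w /=.
  rewrite (enorm_eq0 u0) /dot big1 ?expr0n ?mul0r ?expR0// => i _.
  by rewrite mxE mul0r.
have up : 0 < enorm u by rewrite lt_neqAle eq_sym u0 enorm_ge0.
pose v := (enorm u)^-1 *: u.
have v1 : enorm v = 1.
  by rewrite enormZ ger0_norm ?invr_ge0 ?enorm_ge0// mulVf.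
have Kk' : (K%:E < kappa%:E)%E by rewrite lte_fin.
have hv := psi2_exp_moment (mdot v) (le_lt_trans (psi2_norm_direction v1) Kk').
apply: mean_le_dominated hv => //.
apply: aeW => w /=; rewrite ler_expR ler_wpM2r ?invr_ge0 ?sqr_ge0//.
have -> : dot u (X w) = enorm u * dot v (X w).
  rewrite /dot mulr_sumr; apply: eq_bigr => i _.
  by rewrite mxE mulrA mulrA mulfV// mul1r.
by rewrite exprMn ler_piMl ?sqr_ge0// exprn_ile1// enorm_ge0.
Qed.

End SubGaussian.

Section Ordering.
Variable R : realType.

(** With t the k-th smallest value, the k smallest values lie below t and the
    others above, so subtracting t from k chosen values leaves at least the sum
    of the negative parts. *)
Lemma smallest_sum_le (N k : nat) (a : 'I_N -> R) (pi : 'S_N)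
    (tau : 'I_k -> 'I_N) : injective tau ->
  (forall i j : 'I_N, (i <= j)%N -> a (pi i) <= a (pi j)) ->
  \sum_(i < N | (i < k)%N) a (pi i) <= \sum_(j < k) a (tau j).
Proof.
move=> tau_inj mono.
case: k tau tau_inj => [|k] tau tau_inj; first by rewrite big_pred0// big_ord0.
have kN : (k < N)%N.
  by have := leq_card _ tau_inj; rewrite !card_ord.
pose t := a (pi (Ordinal kN)).
pose h i := Num.min (a i - t) 0.
have h0 i : h i <= 0 by rewrite ge_min lexx orbT.
have c1 : \sum_(i < N | (i < k.+1)%N) t = t *+ k.+1.
  by rewrite -(big_ord_widen N (fun=> t) kN) sumr_const card_ord.
have -> : \sum_(i < N | (i < k.+1)%N) a (pi i) =
    \sum_(i < N | (i < k.+1)%N) (a (pi i) - t) + t *+ k.+1.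
  by rewrite sumrB c1 subrK.
have -> : \sum_(j < k.+1) a (tau j) =
    \sum_(j < k.+1) (a (tau j) - t) + t *+ k.+1.
  by rewrite sumrB sumr_const card_ord subrK.
rewrite lerD2r.
apply: (@le_trans _ _ (\sum_(i < N) h i)); last first.
  apply: (@le_trans _ _ (\sum_(j < k.+1) h (tau j))); last first.
    by apply: ler_sum => j _; rewrite ge_min lexx.
  rewrite -(big_imset h (A := predT) (h := tau))/=; last first.
    by move=> ? ? _ _; exact: tau_inj.
  rewrite [leLHS](bigID (mem [set tau x | x in predT]%SET))/= gerDl.
  by apply: sumr_le0 => i _.
rewrite [leRHS](reindex_inj (@perm_inj _ pi)) /=.
rewrite [leRHS](bigID (fun i : 'I_N => (i < k.+1)%N))/=.
rewrite [X in _ + X]big1 ?addr0; last first.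
  move=> i; rewrite -leqNgt => ki; rewrite /h min_r// subr_ge0.
  exact: (mono (Ordinal kN) i (ltnW ki)).
apply: ler_sum => i ik; rewrite /h le_min lexx subr_le0.
exact: (mono i (Ordinal kN) ik).
Qed.

(** Cauchy-Schwarz against the indicator of the first k indices. *)
Lemma sqr_average_le (N k : nat) (h : 'I_N -> R) : (0 < k)%N -> (k <= N)%N ->
  (k%:R^-1 * \sum_(i < N | (i < k)%N) h i) ^+ 2 <=
    k%:R^-1 * \sum_(i < N | (i < k)%N) h i ^+ 2.
Proof.
move=> k0 kN; have kp : 0 < k%:R :> R by rewrite ltr0n.
pose x : 'cV[R]_N := \col_i (if (i < k)%N then h i else 0).
pose y : 'cV[R]_N := \col_i (if (i < k)%N then 1 else 0).
have xy : dot x y = \sum_(i < N | (i < k)%N) h i.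
  rewrite big_mkcond; apply: eq_bigr => i _; rewrite !mxE.
  by case: ifP; rewrite ?mulr1 ?mulr0.
have xx : dot x x = \sum_(i < N | (i < k)%N) h i ^+ 2.
  rewrite big_mkcond; apply: eq_bigr => i _; rewrite !mxE.
  by case: ifP; rewrite ?expr2 ?mulr0.
have yy : dot y y = k%:R.
  transitivity (\sum_(i < N | (i < k)%N) (1 : R)).
    rewrite [RHS]big_mkcond; apply: eq_bigr => i _; rewrite !mxE.
    by case: ifP; rewrite ?mulr1 ?mulr0.
  by rewrite -(big_ord_widen N (fun=> 1) kN) sumr_const card_ord.
have := cauchy_schwarz x y; rewrite xy xx yy exprMn => h2.
apply: (@le_trans _ _ (k%:R^-1 ^+ 2 *
    ((\sum_(i < N | (i < k)%N) h i ^+ 2) * k%:R))).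
  by rewrite ler_wpM2l.
rewrite le_eqVlt; apply/orP; left; apply/eqP; field; rewrite gt_eqF//.
Qed.

End Ordering.

(** * Noise and bias of the estimator *)

(** As s <= 1 and s2 > 0, the order s1 is 0: smoothness bears on g itself. *)
Lemma smooth_holder (R : realType) (m : nat) (L s : R) (g : 'cV[R]_m -> R) :
  smooth L s g -> s <= 1 ->
  forall z z', `|g z - g z'| <= L * enorm (z - z') `^ s.
Proof.
move=> [s1 [s2 [ss /andP[s20 _] _ h]]] s1le z z'.
have s10 : s1 = 0%N.
  apply/eqP; rewrite -leqn0 -ltnS -(ltr_nat R); apply: lt_le_trans s1le.
  by rewrite ss ltrDl.
have := h [::]; rewrite s10 => /(_ erefl z z').
by rewrite ss s10 add0r.
Qed.

Lemma enorm_delta_le1 (R : realType) (n : nat) (j : 'I_n) :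
  enorm (delta_mx j 0 : 'cV[R]_n) <= 1.
Proof.
rewrite -ler_sqr ?nnegrE ?enorm_ge0// enorm_sqr expr1n /dot (bigD1 j)//=.
rewrite big1 ?addr0 => [|i ij]; rewrite !mxE ?eqxx ?mulr1//.
by rewrite (negbTE ij) mul0r.
Qed.

Lemma orthonormal_columns_gt0 (R : realType) (m n : nat) (A : 'M[R]_(m, n)) :
  orthonormal_columns A -> (0 < n)%N -> (0 < m)%N.
Proof.
case: m A => [|//] A AA n0; have /matrixP/(_ (Ordinal n0) (Ordinal n0)) := AA.
by rewrite !mxE big_ord0 eqxx => /eqP; rewrite eq_sym oner_eq0.
Qed.

Lemma dot_delta (R : realType) (n : nat) (j : 'I_n) (x : 'cV[R]_n) :
  dot (delta_mx j 0) x = x j 0.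
Proof.
rewrite /dot (bigD1 j)//= big1 ?addr0 => [|i ij]; rewrite mxE ?eqxx ?mul1r//.
by rewrite (negbTE ij) mul0r.
Qed.

Section KNN.
Variables (R : realType) (D d N k : nat) (sigma L s : R).
Context {disp : measure_display} {Omega : measurableType disp}.
Variable Pr : probability Omega R.
Variables (X : {RV Pr >-> 'cV[R]_D}) (zeta Y : {RV Pr >-> R})
  (Xs : 'I_N -> {RV Pr >-> 'cV[R]_D}) (Ys : 'I_N -> {RV Pr >-> R})
  (A : 'M[R]_(D, d)) (g : 'cV[R]_d -> R) (Q : 'M[R]_D)
  (rho : N.-tuple 'cV[R]_D -> 'cV[R]_D -> 'S_N) (m v : Omega -> R).

Let f (x : 'cV[R]_D) : R := g (A^T *m x).
Let K : R := fine (psi2_norm_vec Pr X).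
Let p : R := 2 * s.
Let delta : R := spectral_norm (Q - A *m A^T).

Hypothesis AA : orthonormal_columns A.
Hypothesis YE : forall w, Y w = g (A^T *m X w) + zeta w.
Hypothesis sgX : sub_gaussian Pr X.
Hypotheses (zeta_m : cond_expectation Pr X zeta m)
  (m0 : {ae Pr, forall w, m w = 0}).
Hypotheses (zeta_v : cond_variance Pr X zeta v)
  (v_le : {ae Pr, forall w, v w <= sigma ^+ 2}).
Hypothesis QQ : orthogonal_projection Q.
Hypothesis iidZ :
  iid_copies Pr (fun w => (X w, Y w)) (fun i w => (Xs i w, Ys i w)).
Hypothesis nn : nn_ordering Q rho.
Hypotheses (gH : forall z z', `|g z - g z'| <= L * enorm (z - z') `^ s)
  (s01 : 0 < s <= 1) (pd : p < d%:R) (kN : (0 < k <= N)%N).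

Let I : finType := option 'I_N.
Let XX (o : I) : Omega -> 'cV[R]_D := if o is Some i then Xs i else X.
Let YY (o : I) : Omega -> R := if o is Some i then Ys i else Y.
Let ZZ (o : I) (w : Omega) : ('cV[R]_D * R)%type := (XX o w, YY o w).

Let mXX (o : I) : measurable_fun setT (XX o).
Proof. by case: o => [i|]; exact: measurable_funPT. Qed.

Let mYY (o : I) : measurable_fun setT (YY o).
Proof. by case: o => [i|]; exact: measurable_funPT. Qed.

Let mZZ (o : I) : measurable_fun setT (ZZ o).
Proof. by apply: measurable_fun_pair. Qed.

Let mf : measurable_fun setT f.
Proof. by case/andP: s01 => s0 _; exact: (holder_measurable AA s0 gH). Qed.

Let indepZ : mutually_independent Pr ZZ.
Proof.
case: iidZ => ind _; rewrite (_ : ZZ = fun o : I =>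
  if o is Some i then (fun w => (Xs i w, Ys i w))
  else (fun w => (X w, Y w))) //.
by apply/funext => -[].
Qed.

Let sameZ (o : I) : same_distribution Pr (ZZ o) (ZZ None).
Proof. by case: iidZ => _ h; case: o => [i|] B mB //; exact: h. Qed.

Let mean_le_same (o : I) (F : ('cV[R]_D * R)%type -> R) (c : R) :
  measurable_fun setT F -> (forall z, 0 <= F z) ->
  mean_le Pr (fun w => F (ZZ None w)) c -> mean_le Pr (fun w => F (ZZ o w)) c.
Proof.
move=> mF F0 [_ _ hc]; split => //; first exact: measurableT_comp.
have mEF : measurable_fun setT (EFin \o F) by exact/measurable_EFinP.
by rewrite (same_distribution_integral (mZZ o) (mZZ None) (sameZ o) mEF).
Qed.

Let xs (t : #|I|.-tuple 'cV[R]_D) : N.-tuple 'cV[R]_D :=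
  [tuple tnth t (enum_rank (Some i : I)) | i < N].
Let query (t : #|I|.-tuple 'cV[R]_D) : 'cV[R]_D :=
  tnth t (enum_rank (None : I)).

(** The rank of the point i is the inverse ordering applied to i; the query
    itself is never selected. *)
Let selected (o : I) : set (#|I|.-tuple 'cV[R]_D) :=
  if o is Some i then [set t | ((rho (xs t) (query t))^-1%g i < k)%N] else set0.

Let measurable_selected (o : I) : measurable (selected o).
Proof.
case: o => [i|]; last exact: measurable0.
have mxq : measurable_fun setT (fun t => (xs t, query t)).
  apply: measurable_fun_pair; last exact: measurable_tnth.
  apply/measurable_fun_tnthP => j.
  rewrite (_ : _ \o _ =
      fun t : #|I|.-tuple _ => tnth t (enum_rank (Some j : I))).
    exact: measurable_tnth.
  by apply/funext => t /=; rewrite tnth_mktuple.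
rewrite (_ : selected _ = \bigcup_(q in [set q : 'S_N | (q^-1%g i < k)%N])
    ((fun t => (xs t, query t)) @^-1`
      [set z : N.-tuple 'cV[R]_D * 'cV[R]_D | rho z.1 z.2 = q])).
  apply: fin_bigcup_measurable; first exact: finite_finset.
  by move=> q _; rewrite -[X in measurable X]setTI; apply: mxq => //; case: nn.
apply/seteqP; split => [t /= ti|t [q /= qi e]].
  by exists (rho (xs t) (query t)).
by rewrite /= e.
Qed.

Let rank (w : Omega) : 'S_N := rho [tuple Xs i w | i < N] (X w).

Let xs_design (w : Omega) : xs (design XX w) = [tuple Xs i w | i < N].
Proof. by apply: eq_from_tnth => i; rewrite !tnth_mktuple enum_rankK. Qed.

Let query_design (w : Omega) : query (design XX w) = X w.
Proof. by rewrite /query tnth_mktuple enum_rankK. Qed.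

(** Sums over the k first ranks are sums over all members weighted by the
    selection events, which makes them measurable. *)
Let sum_selected (h : I -> R) (w : Omega) :
  \sum_(o : I) h o * \1_(selected o) (design XX w) =
  \sum_(r < N | (r < k)%N) h (Some (rank w r)).
Proof.
rewrite (bigD1 None)//= indic0 mulr0 add0r.
rewrite (reindex_omap Some id)/=; last by case.
rewrite (eq_bigl xpredT); last by move=> i; rewrite eqxx.
rewrite (reindex_inj (@perm_inj _ (rank w)))/= [RHS]big_mkcond/=.
apply: eq_bigr => r _; rewrite indicE.
have -> : (design XX w \in selected (Some (rank w r))) = (r < k)%N.
  by apply/idP/idP; rewrite inE /selected /= xs_design query_design permK.
by case: ifP; rewrite ?mulr1 ?mulr0.
Qed.

Let noise (w : Omega) : R :=
  \sum_(o : I) (YY o w - f (XX o w)) * \1_(selected o) (design XX w).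
Let bias (w : Omega) : R :=
  k%:R^-1 * \sum_(r < N | (r < k)%N) (f (Xs (rank w r) w) - f (X w)).

Let k0 : 0 < k%:R :> R.
Proof. by rewrite ltr0n; case/andP: kN. Qed.

Let sum_first (c : R) : \sum_(r < N | (r < k)%N) c = c * k%:R.
Proof.
case/andP: kN => _ kN'; rewrite -(big_ord_widen N (fun=> c) kN') sumr_const.
by rewrite card_ord mulr_natr.
Qed.

Lemma knn_decomposition (w : Omega) :
  knn_estimator rho k [tuple Xs i w | i < N] [tuple Ys i w | i < N] (X w)
    - f (X w) = k%:R^-1 * noise w + bias w.
Proof.
rewrite /knn_estimator /noise /bias.
rewrite (sum_selected (fun o => YY o w - f (XX o w))).
rewrite -mulrDr -big_split /=.
under [in RHS]eq_bigr do rewrite addrA subrK.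
rewrite sumrB sum_first mulrBr mulrCA mulVf ?gt_eqF// mulr1; congr (_ * _ - _).
by apply: eq_bigr => r _; rewrite tnth_mktuple.
Qed.

Let mselected_indic (o : I) :
  measurable_fun setT (fun w => \1_(selected o) (design XX w) : R).
Proof.
apply: measurableT_comp; last exact: measurable_design.
exact: measurable_indic.
Qed.

Lemma measurable_noise : measurable_fun setT noise.
Proof.
apply: measurable_sum => o; apply: measurable_funM => //.
by apply: measurable_funB => //; exact: measurableT_comp.
Qed.

Lemma measurable_bias : measurable_fun setT bias.
Proof.
rewrite (_ : bias = fun w => k%:R^-1 * \sum_(o : I)
    (f (XX o w) - f (X w)) * \1_(selected o) (design XX w)).
  apply: measurable_funM => //; apply: measurable_sum => o.
  apply: measurable_funM => //.
  by apply: measurable_funB; apply: measurableT_comp.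
by apply/funext => w; rewrite (sum_selected (fun o => f (XX o w) - f (X w))).
Qed.

Lemma mean_noise : mean_le Pr (fun w => (k%:R^-1 * noise w) ^+ 2)
  (sigma ^+ 2 / k%:R).
Proof.
have mres : measurable_fun setT (fun z : 'cV[R]_D * R => z.2 - f z.1).
  apply: measurable_funB; first exact: measurable_snd.
  exact: (measurableT_comp mf measurable_fst).
have resE w : YY None w - f (XX None w) = zeta w.
  by rewrite /YY YE /f addrC addKr.
have mB (B : set 'cV[R]_D) : measurable B ->
    measurable_fun setT (fun z : 'cV[R]_D * R => \1_B z.1 : R).
  move=> mB; apply: measurableT_comp; last exact: measurable_fst.
  exact: measurable_indic.
have int_zeta o : Pr.-integrable setT (EFin \o (fun w => YY o w - f (XX o w))).
  apply: (same_distribution_integrable (mZZ o) (mZZ None) (sameZ o) mres).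
  case: zeta_m => iz _ _ _; move: iz; congr (_.-integrable _ _).
  by apply/funext => w /=; rewrite resE.
have mean_zeta o B : measurable B ->
    (\int[Pr]_w ((YY o w - f (XX o w)) * \1_B (XX o w))%:E = 0)%E.
  move=> mB'; have mF : measurable_fun setT
      (fun z : 'cV[R]_D * R => ((z.2 - f z.1) * \1_B z.1)%:E).
    by apply/measurable_EFinP; apply: measurable_funM => //; exact: mB.
  have := same_distribution_integral (mZZ o) (mZZ None) (sameZ o) mF.
  move=> /= ->; under eq_integral do rewrite resE.
  by apply: (cond_mean_indic _ zeta_m m0) => //; exact: measurable_funPT.
have var_zeta o B : measurable B ->
    (\int[Pr]_w ((YY o w - f (XX o w)) ^+ 2 * \1_B (XX o w))%:E <=
      (sigma ^+ 2)%:E * Pr (XX o @^-1` B))%E.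
  move=> mB'; have mF : measurable_fun setT
      (fun z : 'cV[R]_D * R => ((z.2 - f z.1) ^+ 2 * \1_B z.1)%:E).
    apply/measurable_EFinP; apply: measurable_funM; last exact: mB.
    exact: measurable_funX.
  have := same_distribution_integral (mZZ o) (mZZ None) (sameZ o) mF.
  move=> /= ->; under eq_integral do rewrite resE.
  have -> : Pr (XX o @^-1` B) = Pr (X @^-1` B).
    have mB1 : measurable (fst @^-1` B : set ('cV[R]_D * R)).
      by rewrite -[X in measurable X]setTI; exact: measurable_fst.
    exact: (sameZ o mB1).
  by apply: (cond_variance_indic _ _ zeta_m m0 zeta_v v_le) => //;
    exact: measurable_funPT.
have card_sel w : \sum_(o : I) \1_(selected o) (design XX w) <= k%:R :> R.
  have := sum_selected (fun=> 1) w; rewrite sum_first mul1r => <-.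
  by apply: ler_sum => o _; rewrite mul1r.
have := noise_bound mXX mYY mf indepZ (sqr_ge0 sigma) int_zeta mean_zeta var_zeta
  measurable_selected card_sel.
move=> hn.
have : mean_le Pr (fun w => noise w ^+ 2) (sigma ^+ 2 * k%:R).
  by split => //; [apply: measurable_funX; exact: measurable_noise|
    move=> w; exact: sqr_ge0].
have k2 : 0 <= k%:R^-1 ^+ 2 :> R by rewrite sqr_ge0.
move=> /(mean_leZ k2).
have -> : k%:R^-1 ^+ 2 * (sigma ^+ 2 * k%:R) = sigma ^+ 2 / k%:R.
  by field; rewrite gt_eqF.
by under eq_fun do rewrite -exprMn.
Qed.

Let diff (i : 'I_N) (w : Omega) : 'cV[R]_D := X w - Xs i w.

Let p02 : 0 < p <= 2.
Proof. by rewrite /p; case/andP: s01 => *; apply/andP; split; lra. Qed.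

Lemma bias_sqr_le (w : Omega) : bias w ^+ 2 <= L ^+ 2 *
  (k%:R^-1 * \sum_(r < N | (r < k)%N) enorm (A^T *m diff (rank w r) w) `^ p).
Proof.
case/andP: kN => k1 kN'.
apply: (le_trans (sqr_average_le _ k1 kN')).
rewrite mulrCA ler_wpM2l ?invr_ge0 ?(ltW k0)// mulr_sumr.
apply: ler_sum => r _; set i := rank w r.
have -> : L ^+ 2 * enorm (A^T *m diff i w) `^ p =
    (L * enorm (A^T *m diff i w) `^ s) ^+ 2.
  rewrite exprMn -[(_ `^ s) ^+ 2](powR_mulrn 2) ?powR_ge0// -powRrM.
  by rewrite [s * _]mulrC.
rewrite -real_normK ?num_real// distrC /diff mulmxBr.
have h := gH (A^T *m X w) (A^T *m Xs i w).
by apply: lerXn2r; rewrite ?nnegrE// (le_trans _ h).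
Qed.

Let coordinate_moment (u : 'cV[R]_D) (kappa : R) (o : I) : enorm u <= 1 ->
  K < kappa ->
  mean_le Pr (fun w => expR (dot u (XX o w) ^+ 2 / kappa ^+ 2)) 2.
Proof.
move=> u1 Kk.
have mF : measurable_fun setT
    (fun z : 'cV[R]_D * R => expR (dot u z.1 ^+ 2 / kappa ^+ 2)).
  apply: measurableT_comp; first exact: measurable_expR.
  apply: measurable_funM => //; apply: measurable_funX.
  exact: (measurableT_comp (measurable_dot u) measurable_fst).
have := @mean_le_same o _ 2 mF (fun z => expR_ge0 _); apply.
by have := exp_moment_direction (mXX None) sgX u1 Kk.
Qed.

(** A majorant of every |X_o|^2 / kappa^2 that does not depend on o. *)
Let envelope (kappa : R) (w : Omega) : R :=
  \sum_(j < D) (ln (2 * N.+1%:R) +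
    (2 * N.+1%:R)^-1 * \sum_(o : I) expR (XX o w j 0 ^+ 2 / kappa ^+ 2)).

Lemma mean_envelope (kappa : R) : K < kappa ->
  mean_le Pr (envelope kappa) (D%:R * (ln (2 * N.+1%:R) + 1)).
Proof.
move=> Kk; have m1 : 1 <= 2 * N.+1%:R :> R.
  have : 1 <= N.+1%:R :> R by rewrite ler1n.
  by lra.
have m0' : 0 < 2 * N.+1%:R :> R by lra.
rewrite mulr_natl -[X in _ *+ X](card_ord D) -sumr_const.
apply: mean_le_sum => j _; apply: mean_leD.
  exact: mean_le_cst (ln_ge0 m1).
rewrite -[X in mean_le _ _ X](mulVf (lt0r_neq0 m0')).
apply: mean_leZ; first by rewrite invr_ge0 ltW.
rewrite mulr_natr -{1}(card_ord N) -card_option -sumr_const.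
apply: mean_le_sum => o _.
have e1 := enorm_delta_le1 R j.
have := coordinate_moment o e1 Kk; congr (mean_le _ _ _).
by apply/funext => w; rewrite dot_delta.
Qed.

(** Since y <= ln t + exp y / t, and one exponential is at most the sum of all
    of them, the envelope dominates every index at once: i may depend on the
    sample. *)
Lemma diff_pow_le (kappa : R) (i : 'I_N) (w : Omega) : 0 < kappa ->
  enorm (diff i w) `^ p <= (2 * kappa) `^ p * (1 + envelope kappa w).
Proof.
move=> kp; case/andP: s01 => s0 s1.
have m0' : 0 < 2 * N.+1%:R :> R by rewrite mulr_gt0 ?ltr0n.
have k2 : 0 < kappa ^+ 2 by rewrite exprn_gt0.
have one o : enorm (XX o w) ^+ 2 <= kappa ^+ 2 * envelope kappa w.
  rewrite enorm_sqr /envelope mulr_sumr; apply: ler_sum => j _.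
  rewrite -expr2 mulrC -ler_pdivrMr//.
  apply: (le_trans (le_ln_exp _ m0')); rewrite lerD2l mulrC.
  rewrite ler_wpM2l ?invr_ge0 ?(ltW m0')// (bigD1 o)//= lerDl.
  by apply: sumr_ge0 => *; exact: expR_ge0.
have e0 : 0 <= envelope kappa w.
  by rewrite -(pmulr_rge0 _ k2) (le_trans _ (one None))// sqr_ge0.
have h2 : enorm (diff i w) ^+ 2 <= (2 * kappa) ^+ 2 * envelope kappa w.
  have aux (a b c e : R) : 0 <= a -> 0 <= b -> 0 <= c -> a <= b + c ->
      b ^+ 2 <= e -> c ^+ 2 <= e -> a ^+ 2 <= 2 ^+ 2 * e.
    move=> a0 b0 c0 abc be ce.
    have : a ^+ 2 <= (b + c) ^+ 2 by apply: lerXn2r; rewrite ?nnegrE ?addr_ge0.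
    by have := sqr_ge0 (b - c); rewrite sqrrB sqrrD; lra.
  rewrite exprMn -mulrA; apply: (aux _ (enorm (X w)) (enorm (Xs i w)));
    rewrite ?enorm_ge0//.
  - by have := enormD (X w) (- Xs i w); rewrite enormN.
  - exact: one None.
  - exact: one (Some i).
have -> : enorm (diff i w) `^ p = (enorm (diff i w) ^+ 2) `^ s.
  by rewrite -(powR_mulrn 2) ?enorm_ge0// -powRrM.
have -> : (2 * kappa) `^ p = ((2 * kappa) ^+ 2) `^ s.
  by rewrite -(powR_mulrn 2) ?mulr_ge0 ?(ltW kp)// -powRrM.
apply: (@le_trans _ _ (((2 * kappa) ^+ 2 * envelope kappa w) `^ s)).
  apply: ge0_ler_powR; rewrite ?nnegrE ?(ltW s0) ?sqr_ge0//.
  by rewrite mulr_ge0 ?sqr_ge0.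
rewrite powRM ?sqr_ge0// ler_wpM2l ?powR_ge0//.
by apply: powR_le1D => //; rewrite (ltW s0).
Qed.

(** The j-th entry of A^T Q x, written as a linear form of x whose direction
    has norm at most 1, so that its exponential moments are those of X. *)
Let U (j : 'I_d) (z : 'cV[R]_D * R) : R :=
  dot (Q *m (A *m delta_mx j 0)) z.1.

Let UE (j : 'I_d) (z : 'cV[R]_D * R) : U j z = (A^T *m (Q *m z.1)) j 0.
Proof.
by case: QQ => QT _; rewrite /U !dot_mulmx QT dot_delta.
Qed.

Lemma near_le_gap (i : 'I_N) (w : Omega) : delta <= 2^-1 ->
  enorm (Q *m diff i w) `^ p <= 4 * gap ZZ None U (Some i) w `^ p.
Proof.
move=> d2; case/andP: p02 => p0 p2.
have g0 : 0 <= gap ZZ None U (Some i) w by exact: gap_ge0.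
have h : enorm (Q *m diff i w) <= 2 * gap ZZ None U (Some i) w.
  apply: (le_trans (enorm_projection_coordinates _ AA QQ d2)).
  rewrite ler_wpM2l//; apply: (le_trans (enorm_le_sum _)).
  apply: ler_sum => j _; rewrite !UE /= /diff mulmxBr mulmxBr distrC.
  by rewrite !mxE.
apply: (@le_trans _ _ ((2 * gap ZZ None U (Some i) w) `^ p)).
  apply: ge0_ler_powR; rewrite ?nnegrE ?enorm_ge0 ?(ltW p0)//.
  exact: mulr_ge0.
rewrite powRM// ler_wpM2r ?powR_ge0//.
apply: (@le_trans _ _ (2 `^ 2%:R)); first by apply: ler_powR => //; lra.
by rewrite powR_mulrn//; lra.
Qed.

(** The residue classes modulo k are k disjoint groups of at least N %/ k
    sample points. *)
Let group (j : 'I_k) : {set I} :=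
  [set o : I | if o is Some i then (i %% k == j)%N else false].

Lemma group_size (j : 'I_k) : (N %/ k <= #|group j|)%N.
Proof.
case/andP: kN => k1 kN'.
have lt (t : 'I_(N %/ k)) : (t * k + j < N)%N.
  apply: (@leq_trans ((N %/ k) * k)); last exact: leq_trunc_div.
  apply: (@leq_trans (t.+1 * k)); first by rewrite mulSn addnC ltn_add2r.
  by rewrite leq_mul2r ltn_ord orbT.
pose h (t : 'I_(N %/ k)) : I := Some (Ordinal (lt t)).
have h_inj : injective h.
  move=> t t' [] /eqP; rewrite eqn_add2r eqn_pmul2r// => /eqP.
  exact: val_inj.
rewrite -[leqLHS]card_ord -(card_imset _ h_inj); apply: subset_leq_card.
apply/fintype.subsetP => _ /imsetP[t _ ->].
by rewrite inE /= modnMDl modn_small.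
Qed.

Let group_ratio (j : 'I_k) : N%:R / (2 * k%:R) <= #|group j|%:R :> R.
Proof.
case/andP: kN => k1 kN'.
rewrite ler_pdivrMr ?mulr_gt0// -natrM -natrM ler_nat.
apply: (@leq_trans (N %/ k * (2 * k))); last first.
  by rewrite leq_mul2r group_size orbT.
have := ltn_ceil N k1; have := leq_div2r k kN'; rewrite divnn k1; nia.
Qed.

Let far (kappa : R) (w : Omega) : R :=
  (2 * kappa) `^ p * (1 + envelope kappa w).
Let far_mean (kappa : R) : R :=
  (2 * kappa) `^ p * (1 + D%:R * (ln (2 * N.+1%:R) + 1)).

Let mean_far (kappa : R) : K < kappa -> mean_le Pr (far kappa) (far_mean kappa).
Proof.
move=> Kk; apply: mean_leZ; first exact: powR_ge0.
by apply: mean_leD; [exact: mean_le_cst|exact: mean_envelope].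
Qed.

Let average_cst (c : R) : k%:R^-1 * \sum_(r < N | (r < k)%N) c = c.
Proof. by rewrite sum_first mulrC mulfK// gt_eqF. Qed.

(** |A^T z| = |P z| <= |Q z| + |Q - P| |z|, and (a + b)^p <= 4 (a^p + b^p) for
    p <= 2. *)
Lemma bias_sqr_split (kappa : R) (w : Omega) : 0 < kappa ->
  bias w ^+ 2 <= L ^+ 2 *
    (k%:R^-1 * (\sum_(r < N | (r < k)%N) 4 * enorm (Q *m diff (rank w r) w) `^ p)
      + 4 * (delta `^ p * far kappa w)).
Proof.
move=> kp; case/andP: p02 => p0 p2; apply: (le_trans (bias_sqr_le w)).
rewrite ler_wpM2l ?sqr_ge0// -[X in _ + X]average_cst -mulrDr.
rewrite ler_wpM2l ?invr_ge0 ?(ltW k0)// -big_split /=; apply: ler_sum => r _.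
set z := diff _ w; have d0 : 0 <= delta by exact: spectral_norm_ge0.
apply: (@le_trans _ _ ((enorm (Q *m z) + delta * enorm z) `^ p)).
  apply: ge0_ler_powR; rewrite ?nnegrE ?enorm_ge0 ?(ltW p0)//.
    by rewrite addr_ge0 ?mulr_ge0 ?enorm_ge0.
  exact: enorm_trmx_perturbation.
apply: (le_trans (powRD_le _ _ _)).
- exact: enorm_ge0.
- exact: mulr_ge0 d0 (enorm_ge0 _).
- by rewrite (ltW p0).
rewrite -mulrDr ler_wpM2l// lerD2l powRM ?enorm_ge0//.
by rewrite ler_wpM2l ?powR_ge0// diff_pow_le.
Qed.

(** If |Q - P| > 1/2, then |Q z|^p <= |z|^p <= 4 |Q - P|^p |z|^p and only the
    far term remains. Otherwise the k nearest points are compared with the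
    points tau j, one for each group, that realize the bounds Phi j. *)
Lemma mean_bias (C kappa : R) : 0 <= C -> is_nn_rate d p (K + 1) C ->
  K < kappa -> 0 < kappa ->
  mean_le Pr (fun w => bias w ^+ 2) (L ^+ 2 *
    (16 * (C * (N%:R / (2 * k%:R)) `^ (- (p / d%:R))) +
     20 * (delta `^ p * far_mean kappa))).
Proof.
move=> C0 rateC Kk kp; case/andP: p02 => p0 p2; case/andP: kN => k1 kN'.
have d0 : 0 <= delta by exact: spectral_norm_ge0.
have mb2 : measurable_fun setT (fun w => bias w ^+ 2).
  by apply: measurable_funX; exact: measurable_bias.
have [_ far0 _] := mean_far Kk.
have farm0 : 0 <= far_mean kappa.
  rewrite mulr_ge0 ?powR_ge0// addr_ge0// mulr_ge0// addr_ge0// ln_ge0//.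
  have : 1 <= N.+1%:R :> R by rewrite ler1n.
  by lra.
have r0 : 0 <= C * (N%:R / (2 * k%:R)) `^ (- (p / d%:R)).
  by rewrite mulr_ge0 ?powR_ge0.
have df0 : 0 <= delta `^ p * far_mean kappa by rewrite mulr_ge0 ?powR_ge0.
have [d2|d2] := leP delta 2^-1; last first.
  have h : mean_le Pr (fun w => L ^+ 2 * (20 * (delta `^ p * far kappa w)))
      (L ^+ 2 * (20 * (delta `^ p * far_mean kappa))).
    apply: mean_leZ; first exact: sqr_ge0.
    apply: mean_leZ => //; apply: mean_leZ; first exact: powR_ge0.
    exact: mean_far.
  apply: mean_le_trans (_ : L ^+ 2 * (20 * (delta `^ p * far_mean kappa)) <= _) _.
    by rewrite ler_wpM2l ?sqr_ge0// lerDr mulr_ge0.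
  apply: mean_le_dominated h => //; first by move=> w; exact: sqr_ge0.
  apply: aeW => w; apply: (le_trans (bias_sqr_split w kp)).
  rewrite ler_wpM2l ?sqr_ge0//.
  have -> : 20 * (delta `^ p * far kappa w) =
      16 * (delta `^ p * far kappa w) + 4 * (delta `^ p * far kappa w) by lra.
  rewrite lerD2r -[leRHS]average_cst ler_wpM2l ?invr_ge0 ?(ltW k0)//.
  apply: ler_sum => r _.
  have -> : 16 * (delta `^ p * far kappa w) =
      4 * (4 * delta `^ p * far kappa w) by lra.
  rewrite ler_wpM2l//; apply: (@le_trans _ _ (far kappa w)).
    apply: le_trans (diff_pow_le (rank w r) w kp).
    apply: ge0_ler_powR; rewrite ?nnegrE ?enorm_ge0 ?(ltW p0)//.
    exact: enorm_projection.
  rewrite ler_peMl//.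
  have h4 : (2^-1 : R) `^ 2%:R <= delta `^ p.
    apply: (@le_trans _ _ (2^-1 `^ p)).
      by apply: ger_powR => //; rewrite invr_gt0 ltr0n invf_le1 ?ler1n.
    by apply: ge0_ler_powR; rewrite ?nnegrE ?(ltW p0)// ltW.
  by move: h4; rewrite powR_mulrn//; lra.
have rate j : exists Phi : Omega -> R,
    mean_le Pr Phi (C * #|group j|%:R `^ (- (p / d%:R))) /\
    forall w, exists2 i, i \in group j & gap ZZ None U i w `^ p <= Phi w.
  have gj0 : (0 < #|group j|)%N.
    by apply: leq_trans (group_size j); rewrite divn_gt0.
  have noG : None \notin group j by rewrite inE.
  have mU j' : measurable_fun setT (U j').
    exact: (measurableT_comp (measurable_dot _) measurable_fst).
  have hU o j' : mean_le Pr (fun w => expR (U j' (ZZ o w) ^+ 2 / (K + 1) ^+ 2)) 2.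
    apply: coordinate_moment; last by rewrite ltrDl.
    apply: (le_trans (enorm_projection _ QQ)).
    by rewrite (enorm_orthonormal _ AA) enorm_delta_le1.
  have [Phi hPhi near] := rateC _ _ Pr _ _ _ ZZ None (group j) U mZZ indepZ sameZ
    noG gj0 mU hU.
  by exists Phi.
have [Phi hPhi] := choice rate.
pose h' w := L ^+ 2 * (k%:R^-1 * (\sum_(j < k) 16 * Phi j w) +
  4 * (delta `^ p * far kappa w)).
have mh' : mean_le Pr h' (L ^+ 2 * (k%:R^-1 * (\sum_(j < k) 16 *
    (C * #|group j|%:R `^ (- (p / d%:R)))) + 4 * (delta `^ p * far_mean kappa))).
  apply: mean_leZ; first exact: sqr_ge0.
  apply: mean_leD.
    apply: mean_leZ; first by rewrite invr_ge0 ltW.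
    apply: mean_le_sum => j _; apply: mean_leZ => //.
    by have [] := hPhi j.
  apply: mean_leZ => //; apply: mean_leZ; first exact: powR_ge0.
  exact: mean_far.
apply: mean_le_trans (mean_le_dominated mb2 _ _ mh').
- rewrite ler_wpM2l ?sqr_ge0//; apply: lerD; last by rewrite ler_wpM2r//; lra.
  rewrite mulrC ler_pdivrMr//.
  set c := (16 * (C * (N%:R / (2 * k%:R)) `^ _)).
  have -> : c * k%:R = \sum_(j < k) c.
    by rewrite sumr_const card_ord mulr_natr.
  rewrite /c.
  apply: ler_sum => j _; rewrite ler_wpM2l// ler_wpM2l//.
  have Np : 0 < N%:R / (2 * k%:R) :> R.
    by rewrite divr_gt0 ?mulr_gt0// ltr0n (leq_trans k1).
  rewrite !powRN lef_pV2 ?posrE ?powR_gt0//; last first.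
    exact: lt_le_trans (group_ratio j).
  apply: ge0_ler_powR; rewrite ?nnegrE ?(ltW Np)//.
    by rewrite divr_ge0 ?(ltW p0).
- by move=> w; exact: sqr_ge0.
apply: aeW => w; apply: (le_trans (bias_sqr_split w kp)).
rewrite ler_wpM2l ?sqr_ge0// lerD2r ler_wpM2l ?invr_ge0 ?(ltW k0)//.
have sel (j : 'I_k) : exists i : 'I_N, (i %% k == j)%N /\
    gap ZZ None U (Some i) w `^ p <= Phi j w.
  have [_ /(_ w)[[i|]]] := hPhi j; rewrite inE => // ij h.
  by exists i.
have [tau htau] := choice sel.
have tau_inj : injective tau.
  move=> j j' e; apply/eqP; have [/eqP e1 _] := htau j.
  by have [/eqP e2 _] := htau j'; rewrite -val_eqE /= -e1 -e2 e.
rewrite -mulr_sumr -mulr_sumr.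
have -> : 16 * \sum_(j < k) Phi j w = 4 * (\sum_(j < k) 4 * Phi j w).
  by rewrite -mulr_sumr mulrA; congr (_ * _); lra.
rewrite ler_wpM2l//.
apply: (@le_trans _ _ (\sum_(j < k) enorm (Q *m diff (tau j) w) `^ p)).
  apply: (@smallest_sum_le _ N k (fun i => enorm (Q *m diff i w) `^ p) (rank w)
    tau tau_inj) => i j ij.
  apply: ge0_ler_powR; rewrite ?nnegrE ?enorm_ge0 ?(ltW p0)//.
  have [mono _] := nn.
  by have := mono [tuple Xs i w | i < N] (X w) i j ij; rewrite !tnth_mktuple.
apply: ler_sum => j _; apply: (le_trans (near_le_gap _ _ d2)).
by rewrite ler_wpM2l//; have [] := htau j.
Qed.

(** Free of the factor D, hence fit for N = 1, where ln N = 0 leaves no room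
    for the far term: only the d coordinates A^T (X - X_i) are used, with their
    second moments. *)
Lemma mean_bias_crude : mean_le Pr (fun w => bias w ^+ 2)
  (L ^+ 2 * (1 + N%:R * ((d + d)%:R ^+ 2 * ((d + d)%:R * (2 * (K + 1) ^+ 2))))).
Proof.
case/andP: p02 => p0 p2; case/andP: s01 => s0 s1.
have d0 : (0 < d)%N by rewrite -(ltr0n R) (lt_trans p0).
have K0 : 0 <= K.
  by apply: psi2_norm_vec_ge0 => //; exact: orthonormal_columns_gt0 AA d0.
pose V (j : 'I_d) (z : 'cV[R]_D * R) : R := dot (A *m delta_mx j 0) z.1.
have VE j z : V j z = (A^T *m z.1) j 0 by rewrite /V dot_mulmx dot_delta.
have mV j : measurable_fun setT (V j).
  exact: (measurableT_comp (measurable_dot _) measurable_fst).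
have hV o j : mean_le Pr (fun w => expR (V j (ZZ o w) ^+ 2 / (K + 1) ^+ 2)) 2.
  apply: coordinate_moment; last by rewrite ltrDl.
  by rewrite (enorm_orthonormal _ AA) enorm_delta_le1.
have K1 : 0 < K + 1 by rewrite ltr_wpDl.
have hgap i := mean_gap_pow mZZ None mV d0 (Some i) (isT : (0 < 1)%N) K1 hV.
have : mean_le Pr (fun w => L ^+ 2 *
    (1 + \sum_(i < N) gap ZZ None V (Some i) w ^+ 2))
  (L ^+ 2 * (1 + \sum_(i < N)
    ((d + d)%:R ^+ 2 * ((d + d)%:R * (2 * (K + 1) ^+ 2))))).
  apply: mean_leZ; first exact: sqr_ge0.
  apply: mean_leD; first exact: mean_le_cst.
  apply: mean_le_sum => i _; have := hgap i.
  by rewrite !expr1n mul1r muln1.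
rewrite sumr_const card_ord -[X in 1 + X]mulr_natl; apply: mean_le_dominated.
- by apply: measurable_funX; exact: measurable_bias.
- by move=> w; exact: sqr_ge0.
apply: aeW => w; apply: (le_trans (bias_sqr_le w)).
rewrite ler_wpM2l ?sqr_ge0// -[leRHS]average_cst ler_wpM2l ?invr_ge0 ?(ltW k0)//.
apply: ler_sum => r _; set i := rank w r.
have gapE : enorm (A^T *m diff i w) <= gap ZZ None V (Some i) w.
  apply: (le_trans (enorm_le_sum _)); apply: ler_sum => j _.
  by rewrite !VE /= /diff mulmxBr distrC !mxE.
apply: (@le_trans _ _ ((gap ZZ None V (Some i) w ^+ 2) `^ s)).
  rewrite -(powR_mulrn 2) ?gap_ge0// -powRrM.
  by apply: ge0_ler_powR; rewrite ?nnegrE ?enorm_ge0 ?gap_ge0 ?(ltW p0).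
apply: (le_trans (powR_le1D _ _)); rewrite ?sqr_ge0 ?(ltW s0)// lerD2l.
by rewrite [leRHS](bigD1 i)//= lerDl sumr_ge0// => j _; exact: sqr_ge0.
Qed.

Lemma knn_risk (B : R) : mean_le Pr (fun w => bias w ^+ 2) B ->
  ('E_Pr[fun w => ((knn_estimator rho k [tuple Xs i w | i < N]
     [tuple Ys i w | i < N] (X w) - f (X w)) ^+ 2)%R] <=
   (2 * (sigma ^+ 2 / k%:R) + 2 * B)%:E)%E.
Proof.
move=> hB; rewrite unlock.
have : mean_le Pr (fun w => 2 * (k%:R^-1 * noise w) ^+ 2 + 2 * bias w ^+ 2)
    (2 * (sigma ^+ 2 / k%:R) + 2 * B).
  by apply: mean_leD; apply: mean_leZ => //; exact: mean_noise.
move=> h.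
have [] : mean_le Pr (fun w => (k%:R^-1 * noise w + bias w) ^+ 2)
    (2 * (sigma ^+ 2 / k%:R) + 2 * B).
  apply: mean_le_dominated h.
  - apply: measurable_funX; apply: measurable_funD; last exact: measurable_bias.
    by apply: measurable_funM => //; exact: measurable_noise.
  - by move=> w; exact: sqr_ge0.
  apply: aeW => w; have := sqr_ge0 (k%:R^-1 * noise w - bias w).
  by rewrite sqrrB sqrrD; lra.
move=> _ _; apply: le_trans; rewrite le_eqVlt; apply/orP; left; apply/eqP.
by apply: eq_integral => w _; rewrite knn_decomposition.
Qed.

End KNN.

(** * Bookkeeping of the constants *)

Section Constants.
Variable R : realType.

Lemma ln2_ge_half : 2^-1 <= ln 2 :> R.
Proof.
have := @le_ln1Dx R (- 2^-1); have -> : 1 + - 2^-1 = 2^-1 :> R by lra.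
rewrite lnV ?posrE// => h; have : - 1 < - 2^-1 :> R by lra.
by move=> /h; lra.
Qed.

Lemma log_factor_le (D N : nat) : (0 < D)%N -> (1 < N)%N ->
  1 + D%:R * (ln (2 * N.+1%:R) + 1) <= 7 * (D%:R * ln N%:R) :> R.
Proof.
move=> D0 N1; have N2 : 2 <= N%:R :> R by rewrite ler_nat.
have D1 : 1 <= D%:R :> R by rewrite ler1n.
have l2 : 2^-1 <= ln N%:R :> R.
  by apply: (le_trans ln2_ge_half); rewrite ler_ln ?posrE//; lra.
have l3 : ln (2 * N.+1%:R) <= 3 * ln N%:R :> R.
  rewrite [leRHS]mulr_natl -lnXn; last by lra.
  rewrite ler_ln ?posrE ?exprn_gt0 ?mulr_gt0//; last by lra.
  by rewrite -natr1 !exprS expr0; nra.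
nra.
Qed.

(** This is where the choice of k enters: N / k is of order N^(d / (2 s + d)),
    and its power - 2 s / d has the exponent of the noise term. *)
Lemma sample_ratio_pow (N k d : nat) (s Ck : R) : 0 < s -> (0 < d)%N ->
  (0 < N)%N -> (0 < k)%N -> 0 < Ck ->
  k%:R = Ck * N%:R `^ (2 * s / (2 * s + d%:R)) ->
  (N%:R / (2 * k%:R)) `^ (- (2 * s / d%:R)) =
  (2 * Ck) `^ (2 * s / d%:R) * N%:R `^ (- (2 * s / (2 * s + d%:R))).
Proof.
move=> s0 d0 N0 k0 Ck0 kE.
have dp : 0 < d%:R :> R by rewrite ltr0n.
have Np : 0 < N%:R :> R by rewrite ltr0n.
have kp : 0 < k%:R :> R by rewrite ltr0n.
have sd : 0 < 2 * s + d%:R by rewrite addr_gt0// mulr_gt0.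
have -> : (N%:R / (2 * k%:R)) `^ (- (2 * s / d%:R)) =
    (2 * k%:R / N%:R) `^ (2 * s / d%:R).
  have -> : 2 * k%:R / N%:R = (N%:R / (2 * k%:R))^-1 :> R by rewrite invf_div.
  rewrite -[in RHS]powR_inv1 ?divr_ge0// ?mulr_ge0// ?ltW//.
  by rewrite -powRrM mulN1r.
have -> : 2 * k%:R / N%:R = (2 * Ck) * N%:R `^ (2 * s / (2 * s + d%:R) - 1).
  by rewrite powRB ?(gt_eqF Np) ?implybT// powRr1 ?(ltW Np)// kE !mulrA.
rewrite powRM ?powR_ge0 ?mulr_ge0 ?(ltW Ck0)// -powRrM; congr (_ * _ `^ _).
by field; rewrite !gt_eqF.
Qed.

(** The bound holds for every kappa above K, hence at 2 K when K > 0, and in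
    the limit kappa -> 0 when K = 0. *)
Lemma power_limit (x : \bar R) (B c K p : R) : 0 < p -> 0 <= K -> 0 <= c ->
  (forall kappa, K < kappa -> (x <= (B + c * kappa `^ p)%:E)%E) ->
  (x <= (B + c * (2 * K) `^ p)%:E)%E.
Proof.
move=> p0 K0 c0 h; have [K00|Kn0] := eqVneq K 0; last first.
  apply: h; have : 0 < K by rewrite lt_neqAle eq_sym Kn0.
  by lra.
rewrite K00 mulr0 powR0 ?gt_eqF// mulr0 addr0.
apply/lee_addgt0Pr => e e0; have c1 : 0 < c + 1 by lra.
have t0 : 0 < (e / (c + 1)) `^ p^-1 by rewrite powR_gt0// divr_gt0.
apply: (le_trans (h ((e / (c + 1)) `^ p^-1) _)); first by rewrite K00.
rewrite -EFinD lee_fin lerD2l -powRrM mulVf ?gt_eqF// powRr1.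
  by rewrite mulrA ler_pdivrMr// mulrC ler_wpM2l ?(ltW e0)//; lra.
by rewrite divr_ge0// ltW.
Qed.

End Constants.

(** * The risk bound *)

(** The constants of the rate, gathered into one function of the parameters. *)
Lemma nn_constant (R : realType) : exists Cnn : nat -> R -> R -> R,
  forall d p K, 0 < p < d%:R -> 0 < K ->
    0 <= Cnn d p K /\ is_nn_rate d p K (Cnn d p K).
Proof.
have h (x : nat * R * R) : exists C : R, 0 < x.1.2 < x.1.1%:R -> 0 < x.2 ->
    0 <= C /\ is_nn_rate x.1.1 x.1.2 x.2 C.
  have [pd|] := boolP (0 < x.1.2 < x.1.1%:R); last by exists 0.
  have [K0|] := boolP (0 < x.2); last by exists 0.
  by have [C C0 hC] := nearest_neighbour_rate pd K0; exists C.
have [C hC] := choice h.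
by exists (fun d p K => C (d, p, K)) => d p K; exact: hC (d, p, K).
Qed.

Theorem theorem10 (R : realType) :
  exists C1 c2 : nat -> R -> R -> R -> R -> R -> R,
  forall (D d N k : nat) (sigma Ck L s : R)
    (disp : measure_display) (Omega : measurableType disp)
    (Pr : probability Omega R)
    (X : {RV Pr >-> 'cV[R]_D}) (zeta Y : {RV Pr >-> R})
    (Xs : 'I_N -> {RV Pr >-> 'cV[R]_D}) (Ys : 'I_N -> {RV Pr >-> R})
    (A : 'M[R]_(D, d)) (g : 'cV[R]_d -> R) (Phat : 'M[R]_D)
    (rho : N.-tuple 'cV[R]_D -> 'cV[R]_D -> 'S_N)
    (m v : Omega -> R),
  let f := fun x : 'cV[R]_D => g (A^T *m x) in
  let P := A *m A^T in
  let K := fine (psi2_norm_vec Pr X) in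
  let fhat := fun (w : Omega) (x : 'cV[R]_D) =>
    knn_estimator rho k [tuple Xs i w | i < N] [tuple Ys i w | i < N] x in
  orthonormal_columns A ->
  (forall w, Y w = g (A^T *m X w) + zeta w) ->
  sub_gaussian Pr X ->
  cond_expectation Pr X zeta m -> {ae Pr, forall w, m w = 0} ->
  cond_variance Pr X zeta v -> {ae Pr, forall w, v w <= sigma ^+ 2} ->
  {ae Pr, forall w, `|f (X w)| <= 1} ->
  orthogonal_projection Phat ->
  iid_copies Pr (fun w => (X w, Y w)) (fun i w => (Xs i w, Ys i w)) ->
  nn_ordering Phat rho ->
  smooth L s g -> 0 < s <= 1 -> 2 * s < d%:R ->
  0 < Ck -> (1 <= k <= N)%N ->
  k%:R = Ck * N%:R `^ (2 * s / (2 * s + d%:R)) ->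
  ('E_Pr[fun w => ((fhat w (X w) - f (X w)) ^+ 2)%R] <=
    (C1 d sigma K Ck L s * N%:R `^ (- (2 * s / (2 * s + d%:R)))
     + (c2 d sigma K Ck L s * (D%:R * K ^+ 2)) * ln N%:R
         * spectral_norm (Phat - P) `^ (2 * s))%:E)%E.
Proof.
have [Cnn hCnn] := nn_constant R.
(* The three terms come from the noise, from the nearest-neighbour distances
   and from the case N = 1. The moments are taken at K + 1, above the norm. *)
exists (fun d sigma K Ck L s => 2 * (sigma ^+ 2 / Ck) +
  2 * (L ^+ 2 * (16 * (Cnn d (2 * s) (K + 1) * (2 * Ck) `^ (2 * s / d%:R)))) +
  2 * (L ^+ 2 * (1 + (d + d)%:R ^+ 2 * ((d + d)%:R * (2 * (K + 1) ^+ 2))))).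
(* 280 = 2 * 20 * 7: a factor 2 for adding noise and bias, 20 for the far term
   and 7 for the logarithm. Dividing by K^2 makes room for the factor D K^2; for
   K = 0 the far term vanishes along with it. *)
exists (fun d sigma K Ck L s => 280 * L ^+ 2 * (4 * K) `^ (2 * s) / K ^+ 2).
move=> D d N k sigma Ck L s disp Omega Pr X zeta Y Xs Ys A g Phat rho m v.
move=> f P K fhat AA YE sgX zeta_m m0 zeta_v v_le _ QQ iidZ nn gs s01 sd Ck0 kN.
move=> kE.
have [s0 s1] := andP s01; have [k1 kN'] := andP kN.
have gH := smooth_holder gs s1.
have p0 : 0 < 2 * s by rewrite mulr_gt0.
have dp : 0 < d%:R :> R by exact: lt_trans sd.
have d0 : (0 < d)%N by rewrite -(ltr0n R).
have D0 : (0 < D)%N := orthonormal_columns_gt0 AA d0.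
have N0 : (0 < N)%N by exact: leq_trans kN'.
have mX : measurable_fun setT X by exact: measurable_funPT.
have K0 : 0 <= K by exact: psi2_norm_vec_ge0 mX sgX D0.
have K1 : 0 < K + 1 by rewrite ltr_wpDl.
have pd : 0 < 2 * s < d%:R by rewrite p0.
have [C0 rateC] := hCnn d (2 * s) (K + 1) pd K1.
set C := Cnn _ _ _ in C0 rateC *.
have kp : 0 < k%:R :> R by rewrite ltr0n.
set r := 2 * s / (2 * s + d%:R) in kE *.
have noiseE : sigma ^+ 2 / k%:R = sigma ^+ 2 / Ck * N%:R `^ (- r).
  by rewrite kE powRN invfM mulrA.
set a1 := 2 * (sigma ^+ 2 / Ck).
set a2 := 2 * (L ^+ 2 * (16 * (C * (2 * Ck) `^ (2 * s / d%:R)))).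
set a3 := 2 * (L ^+ 2 * (1 + _)).
have L20 : 0 <= L ^+ 2 by exact: sqr_ge0.
have a20 : 0 <= a2.
  by rewrite mulr_ge0// mulr_ge0// mulr_ge0// mulr_ge0 ?powR_ge0.
have a30 : 0 <= a3.
  rewrite mulr_ge0// mulr_ge0// addr_ge0// mulr_ge0 ?sqr_ge0//.
  by rewrite mulr_ge0// mulr_ge0 ?sqr_ge0.
have Nr0 : 0 <= N%:R `^ (- r) by exact: powR_ge0.
set E := ('E_Pr[_])%E.
have risk B := @knn_risk R D d N k sigma L s disp Omega Pr X zeta Y Xs Ys A g
  Phat rho m v AA YE zeta_m m0 zeta_v v_le iidZ nn gH s01 kN B.
have [N1|N1] := leqP N 1.
  have {N1} N1 : N = 1%N by apply/eqP; rewrite eqn_leq N1.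
  have crude := mean_bias_crude AA sgX iidZ nn gH s01 sd kN.
  apply: (le_trans (risk _ crude)); rewrite lee_fin.
  rewrite noiseE N1 ln1 mulr0 mul0r addr0 powR1 !mulr1 mul1r.
  rewrite -/K -/a1 -/a3; lra.
set dl := spectral_norm (Phat - P).
pose c := 2 * (L ^+ 2 * (20 * (dl `^ (2 * s) *
  (2 `^ (2 * s) * (1 + D%:R * (ln (2 * N.+1%:R) + 1)))))).
have lnN0 : 0 <= 1 + D%:R * (ln (2 * N.+1%:R) + 1) :> R.
  rewrite addr_ge0// mulr_ge0// addr_ge0// ln_ge0//.
  have : 1 <= N.+1%:R :> R by rewrite ler1n.
  by lra.
have c0 : 0 <= c.
  do 3 rewrite mulr_ge0//.
  by rewrite mulr_ge0 ?powR_ge0// mulr_ge0 ?powR_ge0.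
have all_kappa kappa : K < kappa ->
    (E <= ((a1 + a2) * N%:R `^ (- r) + c * kappa `^ (2 * s))%:E)%E.
  move=> Kk; have kap0 : 0 < kappa by exact: le_lt_trans Kk.
  have hb := mean_bias AA sgX QQ iidZ nn gH s01 sd kN C0 rateC Kk kap0.
  apply: (le_trans (risk _ hb)); rewrite lee_fin noiseE.
  rewrite (sample_ratio_pow s0 d0 N0 k1 Ck0 kE) -/r /a1 /a2 /c.
  rewrite [(2 * kappa) `^ _]powRM ?(ltW kap0)// le_eqVlt.
  apply/orP; left; apply/eqP.
  by rewrite /dl /P; ring.
apply: (le_trans (power_limit p0 K0 c0 all_kappa)); rewrite lee_fin.
apply: lerD; first by rewrite ler_wpM2r// lerDl.
have [K00|Kn0] := eqVneq K 0.
  by rewrite K00 mulr0 powR0 ?gt_eqF// !mulr0 expr0n /= !mulr0 !mul0r.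
have -> : 280 * L ^+ 2 * (4 * K) `^ (2 * s) / K ^+ 2 * (D%:R * K ^+ 2) * ln N%:R *
    dl `^ (2 * s) = 40 * (L ^+ 2 * (dl `^ (2 * s) * (4 * K) `^ (2 * s))) *
      (7 * (D%:R * ln N%:R)).
  by field.
have -> : c * (2 * K) `^ (2 * s) =
    40 * (L ^+ 2 * (dl `^ (2 * s) * (4 * K) `^ (2 * s))) *
      (1 + D%:R * (ln (2 * N.+1%:R) + 1)).
  have -> : 4 * K = 2 * (2 * K) by lra.
  by rewrite [(2 * (2 * K)) `^ _]powRM ?mulr_ge0// /c; ring.
rewrite ler_wpM2l ?log_factor_le//.
by rewrite mulr_ge0// mulr_ge0// mulr_ge0 ?powR_ge0.
Qed.
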